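(* Let $M$ be a von Neumann factor acting on a Hilbert space $\mathcal{H}$, and let $\ket{\Psi}\in\mathcal{H}$ be cyclic and separating with respect to $M$. Suppose that there exists an increasing sequence $(M_n)_{n\in\mathbb{N}}$ of finite-dimensional unital simple ($*$-)subalgebras of $M$ such that $$\sup_{n\in\mathbb{N}}S(\ket{\Psi},M_n)<\infty$$ and $M$ is the closure of $\bigcup_n M_n$ in the weak operator topology. Then $M$ has type $I$.
   Context: Hilbert spaces are separable. $\ket{\Psi}$ is a unit vector. For a finite-dimensional factor $M_n\cong\mathcal{B}(\mathcal{H}_n)$ acting on $\mathcal{H}$, $S(\ket{\Psi},M_n)=-\mathrm{Tr}\,\rho_n\log\rho_n$ is the von Neumann entropy of the restriction to $M_n$ of the vector state of $\ket{\Psi}$, where $\rho_n$ is the corresponding density matrix on $\mathcal{H}_n$. ''Unital'' means containing the identity of $M$. *)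

(* Defs.v *)
From HB Require Import structures.
From mathcomp Require Import all_boot all_order all_algebra.
From mathcomp Require Import sesquilinear spectral.
From mathcomp Require Import all_classical all_reals all_analysis.
From mathcomp Require Import complex.

Set Implicit Arguments.
Unset Strict Implicit.
Unset Printing Implicit Defensive.

Import Order.TTheory GRing.Theory Num.Theory.
Import numFieldNormedType.Exports.

Local Open Scope classical_set_scope.
Local Open Scope complex_scope.
Local Open Scope ring_scope.
Local Open Scope sesquilinear_scope.

(* The library's forms are linear in the FIRST argument and conjugate-linear in
   the second: the Dirac bracket <x|y> is [inner y x]. *)
Record hilbertType (R : realType) := HilbertType {
  hilbert_sort :> completeNormedModType R[i] ;
  inner : {dot hilbert_sort for (@Num.conj R[i])} ;
  inner_norm : forall x : hilbert_sort, `|x| ^+ 2 = inner x x }.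

Arguments inner {R h} : rename.

Definition separable_space (T : topologicalType) : Prop :=
  exists2 D : set T, countable D & dense D.

Section Operators.
Context {R : realType} {H : hilbertType R}.
Implicit Types (a b e z x : H -> H) (A M I : set (H -> H)) (Psi : H).

(* Operators are bare functions H -> H: sums and scalings are the pointwise
   ones, the product is composition, the unit is [idfun]. *)
Definition bounded_op : set (H -> H) :=
  [set a | linear a /\ exists C : R[i], forall v : H, `|a v| <= C * `|v| ].

Definition is_adjoint a b : Prop :=
  forall v w : H, inner (a v) w = inner v (b w).

Definition star_subalgebra A : Prop :=
  [/\ A `<=` bounded_op,
      A 0 /\ (forall (c : R[i]) a b, A a -> A b -> A (c *: a + b)),
      forall a b, A a -> A b -> A (a \o b)
    & forall a, A a -> exists2 b, A b & is_adjoint a b ].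

Definition commutant A : set (H -> H) :=
  [set b | bounded_op b /\ forall a, A a -> a \o b = b \o a ].

Definition von_neumann_algebra M : Prop :=
  star_subalgebra M /\ commutant (commutant M) = M.

Definition vn_center M : set (H -> H) := M `&` commutant M.

Definition is_factor M : Prop :=
  von_neumann_algebra M /\ vn_center M = range (fun c : R[i] => c *: (idfun : H -> H)).

Definition cyclic_vector M Psi : Prop := dense [set a Psi | a in M].

Definition separating_vector M Psi : Prop :=
  forall a, M a -> a Psi = 0 -> a = 0.

(* The weak operator topology: the coarsest one making all the matrix
   coefficients a |-> inner (a v) w continuous. *)
Definition matrix_coefficients (a : H -> H) : {ptws H * H -> R[i]^o} :=
  fun vw => inner (a vw.1) vw.2.

Definition wot : topologicalType := initial_topology matrix_coefficients.

(* On bare functions the topology also has unbounded linear maps as limits,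
   hence the intersection: closures are taken inside B(H). *)
Definition wot_closure A : set (H -> H) :=
  bounded_op `&` (closure (A : set wot) : set (H -> H)).

Definition finite_dimensional A : Prop :=
  exists (k : nat) (b : 'I_k -> H -> H),
    A = range (fun c : 'I_k -> R[i] => \sum_(i < k) c i *: b i).

Definition two_sided_ideal A I : Prop :=
  [/\ I `<=` A,
      I 0 /\ (forall (c : R[i]) x y, I x -> I y -> I (c *: x + y))
    & forall a x, A a -> I x -> I (a \o x) /\ I (x \o a) ].

Definition simple_algebra A : Prop :=
  (exists2 a, A a & a <> 0) /\
  (forall I, two_sided_ideal A I -> I = [set 0] \/ I = A).

Definition projection_in M e : Prop :=
  [/\ M e, e \o e = e & is_adjoint e e ].

Definition abelian_projection M e : Prop :=
  projection_in M e /\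
  (forall a b, M a -> M b ->
     (e \o a \o e) \o (e \o b \o e) = (e \o b \o e) \o (e \o a \o e)).

(* Murray-von Neumann type I: every nonzero central projection majorizes a
   nonzero abelian projection ([z \o e = e] says e <= z). *)
Definition type_I M : Prop :=
  forall z, projection_in (vn_center M) z -> z <> 0 ->
  exists e, [/\ abelian_projection M e, e <> 0 & z \o e = e ].

Definition matrix_star_iso d (phi : 'M[R[i]]_d -> H -> H) A : Prop :=
  [/\ injective phi /\ range phi = A,
      linear phi,
      forall X Y : 'M[R[i]]_d, phi (X *m Y) = phi X \o phi Y
    & forall X : 'M[R[i]]_d, is_adjoint (phi X) (phi (X ^t (@Num.conj R[i]))) ].

(* rho is the density matrix of the restriction of the vector state of Psi:
   Tr (rho X) = <Psi| phi(X) Psi>. *)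
Definition is_density_matrix d (phi : 'M[R[i]]_d -> H -> H) Psi
    (rho : 'M[R[i]]_d) : Prop :=
  forall X : 'M[R[i]]_d, \tr (rho *m X) = inner (phi X Psi) Psi.

End Operators.

(* Functional calculus for the logarithm; [ln 0 = 0] in the library, so that
   0 log 0 = 0 below. *)
Definition mx_log (R : realType) d (rho : 'M[R[i]]_d) : 'M[R[i]]_d :=
  invmx (spectralmx rho)
    *m diag_mx (map_mx (fun t : R[i] => (ln (complex.Re t))%:C) (spectral_diag rho))
    *m spectralmx rho.

Definition von_neumann_entropy (R : realType) d (rho : 'M[R[i]]_d) : R :=
  - complex.Re (\tr (rho *m mx_log rho)).

(* S(Psi, A), computed through an arbitrary *-isomorphism of A with a full
   matrix algebra; the value does not depend on that choice.  The default 0 is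
   only used when A is not a finite-dimensional factor. *)
Definition restricted_entropy (R : realType) (H : hilbertType R)
    (Psi : H) (A : set (H -> H)) : R :=
  xget 0 [set s : R |
    exists (d : nat) (phi : 'M[R[i]]_d -> H -> H) (rho : 'M[R[i]]_d),
      [/\ matrix_star_iso phi A, is_density_matrix phi Psi rho
        & s = von_neumann_entropy rho ] ].

(* Main.v *)
Require Import Defs.
From HB Require Import structures.
From mathcomp Require Import all_boot all_order all_algebra.
From mathcomp Require Import sesquilinear spectral.
From mathcomp Require Import all_classical all_reals all_analysis.
From mathcomp Require Import complex ring lra.

(** Bounded entropy gives, with c = exp (- sup S), an eigenvalue p_n >= c of every
    density matrix rho_n.  Let e_n be a minimal projection of M_n below the
    corresponding eigenprojection.  For x in M_n the operator e_n x^* x e_n is a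
    scalar multiple t e_n with t p_n <= Tr (rho_n x^* x), hence
      |x e_n v| <= c^(-1/2) |x Psi| |v|   for x in M_n,
    and <e_n Psi, Psi> = p_n >= c.  Both estimates survive in a weak limit e of the
    e_n, which lies in M, and by weak density the first one extends to all x in M.
    A spectral projection q of e on which e >= c / 2 is nonzero, and every nonzero
    projection y <= q of M satisfies |y Psi| >= c^(3/2) / 2.  Hence a projection y
    below q with |y Psi|^2 close enough to the infimum cannot be split, so it is
    abelian; in a factor this means type I. *)

Set Implicit Arguments.
Unset Strict Implicit.
Unset Printing Implicit Defensive.

Import Order.TTheory GRing.Theory Num.Theory.
Import numFieldNormedType.Exports.
Local Open Scope classical_set_scope.
Local Open Scope complex_scope.
Local Open Scope ring_scope.
Local Open Scope sesquilinear_scope.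

(** The norm |x e v| is not weakly continuous in x, and the approximants of an element x of M that
    weak density supplies carry no control of |x Psi|. The extension to M therefore goes through a
    linear identity: for fixed v and w, the bounded functional x Psi |-> <x e v, w> on the union of
    the M_n is represented by a vector z, and <x e v, w> = <x Psi, z> is an equality between matrix
    coefficients of x, which passes to the weak closure. A weak limit of projections need not be a
    projection, so spectral projections of self-adjoint elements of M are required; they come from
    |a| = sqrt (a^2), and a power series for the square root with nonnegative coefficients keeps all
    approximations monotone. The threshold c / 2 works since e <= c / 2 would contradict <e Psi,
    Psi> >= c at the unit vector Psi. *)

(** * Real-valued norms on complex normed spaces *)

Section RealNorm.
Context {R : realType}.
Implicit Types (c z : R[i]) (V : normedZmodType R[i]).

(** Norms take values in [R[i]]; the real-valued version is what the tactics for ordered fields can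
    handle. *)
Definition rnorm V (v : V) : R := complex.Re `|v|.

Lemma rnormE V (v : V) : `|v| = (rnorm v)%:C.
Proof. by rewrite /rnorm RRe_real// ger0_real. Qed.

Lemma rnorm_ge0 V (v : V) : 0 <= rnorm v.
Proof. by rewrite -ler0c -rnormE. Qed.

Lemma rnorm0 V : rnorm (0 : V) = 0.
Proof. by apply: (@complexI R); rewrite -rnormE normr0. Qed.

Lemma rnorm_eq0 V (v : V) : rnorm v = 0 -> v = 0.
Proof. by move=> v0; apply/eqP; rewrite -normr_eq0 rnormE v0. Qed.

Lemma ler_rnormD V (u v : V) : rnorm (u + v) <= rnorm u + rnorm v.
Proof. by rewrite -lecR rmorphD /= -!rnormE ler_normD. Qed.

Lemma rnormN V (v : V) : rnorm (- v) = rnorm v.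
Proof. by rewrite /rnorm normrN. Qed.

Lemma rnorm_distC V (u v : V) : rnorm (u - v) = rnorm (v - u).
Proof. by rewrite /rnorm distrC. Qed.

Lemma rnormZ (W : normedModType R[i]) c (v : W) :
  rnorm (c *: v) = rnorm c * rnorm v.
Proof. by apply: (@complexI R); rewrite rmorphM /= -!rnormE normrZ. Qed.

Lemma rnormM c z : rnorm (c * z) = rnorm c * rnorm z.
Proof. by apply: (@complexI R); rewrite rmorphM /= -!rnormE normrM. Qed.

Lemma rnorm_conj z : rnorm z^*%C = rnorm z.
Proof. by rewrite /rnorm norm_conjC. Qed.

Lemma ler_Re_rnorm z : `|complex.Re z| <= rnorm z.
Proof. by rewrite -lecR -rnormE normc_ge_Re. Qed.

Lemma rnorm_real (x : R) : 0 <= x -> rnorm x%:C = x.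
Proof. by move=> x0; rewrite /rnorm ger0_norm ?ler0c. Qed.

Lemma ReD z c : complex.Re (z + c) = complex.Re z + complex.Re c.
Proof. by case: z c => [? ?] []. Qed.

Lemma ReN z : complex.Re (- z) = - complex.Re z.
Proof. by case: z. Qed.

Lemma ReZ (x : R) z : complex.Re (x%:C * z) = x * complex.Re z.
Proof. by case: z => a b /=; rewrite mul0r subr0. Qed.

Lemma Re_conj z : complex.Re z^*%C = complex.Re z.
Proof. by case: z. Qed.

Lemma Re_mulJ z : complex.Re (z^*%C * z) = rnorm z ^+ 2.
Proof.
apply: (@complexI R); rewrite rmorphXn /= -rnormE normCK mulrC RRe_real//.
by rewrite ger0_real// mul_conjC_ge0.
Qed.

Lemma complex_eq_Re (z c : R[i]) : complex.Re z = complex.Re c ->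
  complex.Re ('i%C * z) = complex.Re ('i%C * c) -> z = c.
Proof.
rewrite -![in _ -> _](mulrC _ 'i%C) !ReiNIm => re /oppr_inj im.
by rewrite (complexE z) re im -complexE.
Qed.

End RealNorm.

(** Discriminant criterion, used for Cauchy-Schwarz inequalities and for the first-order condition
    in [riesz]. *)
Lemma quad_ge0 (R : realFieldType) (a b c : R) :
  (forall t, 0 <= a + 2 * t * b + t ^+ 2 * c) -> b ^+ 2 <= a * c.
Proof.
move=> h; have [c0|c0|c0] := ltgtP c 0.
(* This t satisfies a + t^2 c <= c < 0, whereas adding the values at t and - t gives a + t^2 c >=
   0. *)
- pose t := 1 - a / c; have tc : t * c = c - a by rewrite /t; field; rewrite ltr0_neq0.
  have a0 : 0 <= a by have := h 0; rewrite expr0n /= !mul0r mulr0 mul0r !addr0.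
  have t1 : 1 <= t by rewrite /t lerDl oppr_ge0 mulr_ge0_le0 // invr_le0 ltW.
  have t2 : t ^+ 2 * c <= c - a.
    by rewrite expr2 -mulrA tc ler_neMl //; lra.
  have := h t; have := h (- t); rewrite sqrrN; lra.
- have := h (- b / c); set t := _ / _; have tc : t * c = - b by rewrite /t; field; rewrite lt0r_neq0.
  move=> {}h; have : 0 <= c * (a + 2 * t * b + t ^+ 2 * c) by rewrite mulr_ge0// ltW.
  have -> : c * (a + 2 * t * b + t ^+ 2 * c) = a * c + 2 * b * (t * c) + (t * c) ^+ 2 by ring.
  by rewrite tc; lra.
- subst c; rewrite mulr0; suff -> : b = 0 by rewrite expr0n.
  apply/eqP; apply/negPn/negP => b0.
  have := h (- (a + 1) / (2 * b)); rewrite mulr0 addr0.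
  have -> : 2 * (- (a + 1) / (2 * b)) * b = - (a + 1) by field.
  lra.
Qed.

Lemma squeeze_le (R : realFieldType) (a b : R) :
  (forall e, 0 < e -> a <= b + e) -> a <= b.
Proof.
move=> h; rewrite leNgt; apply/negP => ab.
by have := h ((a - b) / 2); lra.
Qed.

(** * Inner products, completeness and Riesz representation *)

Section Inner.
Context {R : realType} {H : hilbertType R}.
Implicit Types (u v w : H) (c z : R[i]) (a b : H -> H).

Lemma innerDl u v w : inner (u + v) w = inner u w + inner v w.
Proof. exact: linearDl. Qed.

Lemma innerZl c u v : inner (c *: u) v = c * inner u v.
Proof. exact: linearZl_LR. Qed.

Lemma innerC u v : inner u v = (inner v u)^*%C.
Proof. by rewrite hermC expr0 mul1r. Qed.

Lemma innerDr u v w : inner w (u + v) = inner w u + inner w v.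
Proof. exact: linearDr. Qed.

Lemma innerZr c u v : inner u (c *: v) = c^*%C * inner u v.
Proof. exact: linearZr_LR. Qed.

Lemma innerNl u v : inner (- u) v = - inner u v.
Proof. exact: linearNl. Qed.

Lemma innerNr u v : inner u (- v) = - inner u v.
Proof. exact: linearNr. Qed.

Lemma inner0l v : inner 0 v = 0.
Proof. exact: linear0l. Qed.

Lemma inner0r v : inner v 0 = 0.
Proof. by rewrite innerC inner0l conjc0. Qed.

(** A symmetric real bilinear form, suited to order arguments; replacing u by i u recovers the
    imaginary part of [inner]. *)
Definition rinner u v : R := complex.Re (inner u v).

Lemma rinnerDl u v w : rinner (u + v) w = rinner u w + rinner v w.
Proof. by rewrite /rinner innerDl ReD. Qed.

Lemma rinnerC u v : rinner u v = rinner v u.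
Proof. by rewrite /rinner innerC Re_conj. Qed.

Lemma rinnerDr u v w : rinner w (u + v) = rinner w u + rinner w v.
Proof. by rewrite /rinner innerDr ReD. Qed.

Lemma rinnerNl u v : rinner (- u) v = - rinner u v.
Proof. by rewrite /rinner innerNl ReN. Qed.

Lemma rinnerNr u v : rinner u (- v) = - rinner u v.
Proof. by rewrite /rinner innerNr ReN. Qed.

Lemma rinnerZl (t : R) u v : rinner (t%:C *: u) v = t * rinner u v.
Proof. by rewrite /rinner innerZl ReZ. Qed.

Lemma rinnerZr (t : R) u v : rinner u (t%:C *: v) = t * rinner u v.
Proof. by rewrite rinnerC rinnerZl rinnerC. Qed.

Lemma rinner0l v : rinner 0 v = 0.
Proof. by rewrite /rinner inner0l. Qed.

Lemma rinner0r v : rinner v 0 = 0.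
Proof. by rewrite rinnerC rinner0l. Qed.

Definition rinnerE := (rinnerDl, rinnerDr, rinnerNl, rinnerNr, rinnerZl, rinnerZr,
  rinner0l, rinner0r).

Lemma innervv v : inner v v = ((rnorm v) ^+ 2)%:C.
Proof. by rewrite rmorphXn /= -rnormE inner_norm. Qed.

Lemma rinnervv v : rinner v v = rnorm v ^+ 2.
Proof. by rewrite /rinner innervv. Qed.

Lemma inner_eq_Re u v u' v' : (forall c, rinner (c *: u) v = rinner (c *: u') v') ->
  inner u v = inner u' v'.
Proof.
move=> h; apply: complex_eq_Re; last by rewrite -!innerZl; exact: h.
by have := h 1; rewrite !scale1r.
Qed.

Lemma eq_inner u v : (forall w, inner u w = inner v w) -> u = v.
Proof.
move=> h; apply/eqP; rewrite -subr_eq0; apply/eqP; apply: rnorm_eq0.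
apply/eqP; rewrite -sqrf_eq0 -rinnervv /rinner innerDl innerNl h subrr.
by [].
Qed.

Lemma eq_inner_r u v : (forall w, inner w u = inner w v) -> u = v.
Proof. by move=> h; apply: eq_inner => w; rewrite innerC h -innerC. Qed.

Lemma ext_inner a b : (forall v w, inner (a v) w = inner (b v) w) -> a = b.
Proof. by move=> h; apply/funext => v; apply: eq_inner => w; exact: h. Qed.

Section Linear.
Variables (a : H -> H) (lina : linear a).

Lemma lin0 : a 0 = 0.
Proof. by have := lina (-1) 0 0; rewrite scaler0 addr0 scaleN1r addNr. Qed.

Lemma linD u v : a (u + v) = a u + a v.
Proof. by have := lina 1 u v; rewrite !scale1r. Qed.

Lemma linZ c u : a (c *: u) = c *: a u.
Proof. by have := lina c u 0; rewrite lin0 !addr0. Qed.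

Lemma linN u : a (- u) = - a u.
Proof. by rewrite -scaleN1r linZ scaleN1r. Qed.

Lemma linB u v : a (u - v) = a u - a v.
Proof. by rewrite linD linN. Qed.

End Linear.

(** The polynomial t |-> <a (u + t v), u + t v> is nonnegative. A general positive operator a is
    needed for [sqrt_iter_cauchy] and [selfadjoint_eq0]. *)
Lemma psd_CauchySchwarz a : linear a -> (forall u v, rinner (a u) v = rinner u (a v)) ->
  (forall v, 0 <= rinner (a v) v) ->
  forall u v, rinner (a u) v ^+ 2 <= rinner (a u) u * rinner (a v) v.
Proof.
move=> la sa pa u v; apply: quad_ge0 => t.
have := pa (u + t%:C *: v); rewrite linD// linZ// !rinnerE.
by rewrite (sa v u) (rinnerC v); lra.
Qed.

Lemma rinner_CauchySchwarz u v : `|rinner u v| <= rnorm u * rnorm v.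
Proof.
have : rinner u v ^+ 2 <= rinner u u * rinner v v.
  by apply: (@psd_CauchySchwarz idfun) => // w; rewrite rinnervv sqr_ge0.
rewrite !rinnervv -exprMn => h.
by rewrite -(ler_pXn2r (n := 2))// ?nnegrE ?mulr_ge0 ?rnorm_ge0// real_normK ?num_real.
Qed.

Lemma inner_CauchySchwarz u v : rnorm (inner u v) <= rnorm u * rnorm v.
Proof.
have [->|n0] := eqVneq (rnorm (inner u v)) 0; first by rewrite mulr_ge0 ?rnorm_ge0.
have n1 : 0 < rnorm (inner u v) by rewrite lt_def n0 rnorm_ge0.
(* Multiplying u by the conjugate of <u, v> turns the inner product with v into the real number |<u,
   v>|^2. *)
have := rinner_CauchySchwarz ((inner u v)^*%C *: u) v.
rewrite /rinner innerZl Re_mulJ rnormZ rnorm_conj -mulrA ger0_norm ?sqr_ge0//.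
by rewrite expr2 ler_pM2l.
Qed.

Lemma complete_seq (x : nat -> H) :
  (forall e : R, 0 < e ->
     exists n, forall k l, (n <= k)%N -> (n <= l)%N -> rnorm (x k - x l) < e) ->
  exists z : H, forall e : R, 0 < e -> exists n, forall k, (n <= k)%N -> rnorm (x k - z) < e.
Proof.
move=> cau; have : cvg (x @ \oo).
  apply: cauchy_cvg; apply: cauchy_exP => e e0.
  have [r [Er r0]] : exists r : R, e = r%:C /\ 0 < r.
    exists (complex.Re e); rewrite RRe_real ?gtr0_real//; split => //.
    by move: e0; rewrite ltcE => /andP[].
  have [n xn] := cau _ r0; exists (x n); exists n => // k /= nk.
  by rewrite -ball_normE /= rnormE Er ltcR; exact: xn.
move/cvgP; set z := lim _ => xz; exists z => e e0.
have /cvgrPdist_lt /(_ e%:C) : x @ \oo --> z by [].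
rewrite ltcR => /(_ e0)[n _ xn]; exists n => k nk.
by have := xn k nk; rewrite /= rnormE ltcR rnorm_distC.
Qed.

(* The minimizing sequences of |j x|^2 - 2 Re (f x) over N have Cauchy images under j.
   N and j are general in order to cover at once the Riesz representation theorem,
   orthogonal projections, and functionals of x in N bounded by |x Psi|. *)
Lemma riesz (T : lmodType R[i]) (N : set T) (j : T -> H) (f : T -> R[i]) (K : R) :
  N 0 -> (forall c x y, N x -> N y -> N (c *: x + y)) ->
  (forall c x y, N x -> N y -> j (c *: x + y) = c *: j x + j y) ->
  (forall c x y, N x -> N y -> f (c *: x + y) = c * f x + f y) ->
  (forall x, N x -> rnorm (f x) <= K * rnorm (j x)) ->
  exists z : H, (forall e : R, 0 < e -> exists2 x, N x & rnorm (j x - z) < e) /\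
    (forall x, N x -> f x = inner (j x) z).
Proof.
move=> N0 Nlin jlin flin fK.
have NZ c x : N x -> N (c *: x) by move=> Nx; rewrite -[_ *: _]addr0; apply: Nlin.
have ND x y : N x -> N y -> N (x + y).
  by move=> Nx Ny; rewrite -[x]scale1r; apply: Nlin.
have j0 : j 0 = 0.
  by have := jlin (-1) 0 0 N0 N0; rewrite scaler0 addr0 scaleN1r addNr.
have f0 : f 0 = 0.
  by have := flin (-1) 0 0 N0 N0; rewrite scaler0 addr0 mulN1r addNr.
have jZ c x : N x -> j (c *: x) = c *: j x.
  by move=> Nx; rewrite -[_ *: x]addr0 jlin// j0 addr0.
have fZ c x : N x -> f (c *: x) = c * f x.
  by move=> Nx; rewrite -[_ *: x]addr0 flin// f0 addr0.
have jD x y : N x -> N y -> j (x + y) = j x + j y.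
  by move=> Nx Ny; rewrite -[x]scale1r jlin// !scale1r.
have fD x y : N x -> N y -> f (x + y) = f x + f y.
  by move=> Nx Ny; rewrite -[x in LHS]scale1r flin// mul1r.
pose g x := rnorm (j x) ^+ 2 - 2 * complex.Re (f x).
have glb x : N x -> - K ^+ 2 <= g x.
  move=> Nx; have := fK _ Nx; have := ler_Re_rnorm (f x); rewrite ler_norml => /andP[_].
  by have := sqr_ge0 (rnorm (j x) - K); rewrite /g; nra.
have Ghas : has_inf (g @` N).
  split; first by exists (g 0), 0.
  by exists (- K ^+ 2) => _ [x Nx <-]; exact: glb.
pose m := inf (g @` N).
have gm x : N x -> m <= g x by move=> Nx; apply: ge_inf; [case: Ghas|exists x].
(* Parallelogram law, with g >= m at the midpoint of x and y. *)
have mid x y : N x -> N y ->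
    rnorm (j x - j y) ^+ 2 <= 2 * (g x - m) + 2 * (g y - m).
  move=> Nx Ny; have := gm _ (NZ (2^-1)%:C _ (ND _ _ Nx Ny)).
  rewrite /g jZ ?fZ ?jD ?fD//; try exact: ND.
  by rewrite -!rinnervv !rinnerE !ReZ !ReD (rinnerC (j y) (j x)); lra.
have /choice[x xP] : forall k : nat, exists x, N x /\ g x < m + k.+1%:R^-1.
  move=> k; have k0 : 0 < k.+1%:R^-1 :> R by rewrite invr_gt0 ltr0n.
  by have [_ [x Nx <-] gx] := inf_adherent k0 Ghas; exists x; split; [|exact: gx].
have small (e : R) : 0 < e -> exists n, forall k, (n <= k)%N -> g (x k) - m < e.
  move=> e0; have [n ne] : exists n : nat, n.+1%:R^-1 < e.
    exists (Num.truncn e^-1); rewrite -[ltRHS]invrK ltf_pV2 ?posrE ?ltr0n ?invr_gt0//.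
    by rewrite truncnS_gt.
  exists n => k nk; have := (xP k).2; have : k.+1%:R^-1 <= n.+1%:R^-1 :> R.
    by rewrite lef_pV2 ?posrE ?ltr0n// ler_nat.
  move=> h1 h2; rewrite ltrBlDl; apply: lt_trans h2 _; rewrite ltrD2l.
  exact: le_lt_trans h1 ne.
have [|z zP] := @complete_seq (fun k => j (x k)).
  move=> e e0; have [|n nP] := small (e ^+ 2 / 4); first by rewrite divr_gt0 ?exprn_gt0.
  exists n => k l nk nl; rewrite -(ltr_pXn2r (n := 2))// ?nnegrE ?rnorm_ge0 ?ltW//.
  apply: le_lt_trans (mid _ _ (xP k).1 (xP l).1) _.
  by have := nP k nk; have := nP l nl; lra.
exists z; split.
  move=> e e0; have [n nP] := zP _ e0; exists (x n); first exact: (xP n).1.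
  exact: nP.
suff key y : N y -> complex.Re (f y) = rinner (j y) z.
  move=> y Ny; apply: complex_eq_Re; first exact: key.
  by rewrite -fZ// -innerZl -jZ//; apply: key; exact: NZ.
move=> Ny; set L := rinner (j y) z.
(* First-order condition at the minimum: in the limit, g (x_k + t y) >= m reads 0 <= 2 t (L - Re (f
   y)) + t^2 |j y|^2 for all t. *)
suff : (L - complex.Re (f y)) ^+ 2 <= 0 * rnorm (j y) ^+ 2.
  rewrite mul0r => h; apply/eqP; rewrite eq_sym -subr_eq0 -sqrf_eq0 eq_le h.
  exact: sqr_ge0.
apply: quad_ge0 => t; apply: squeeze_le => e e0.
(* Chosen so that 2 |t| r |j y| <= e / 2; the other half of e is spent on g (x_k) - m. *)
pose r := e / (2 * (1 + 2 * `|t| * rnorm (j y))).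
have p0 : 0 < 1 + 2 * `|t| * rnorm (j y).
  by rewrite ltr_wpDr// !mulr_ge0 ?rnorm_ge0.
have r0 : 0 < r by rewrite divr_gt0// mulr_gt0.
have [n1 n1P] := zP _ r0; have [|n2 n2P] := small (e / 2); first by rewrite divr_gt0.
pose k := maxn n1 n2.
have h1 := n1P k (leq_maxl _ _); have h2 := n2P k (leq_maxr _ _).
have Nk := (xP k).1.
have := gm _ (ND _ _ Nk (NZ t%:C _ Ny)).
rewrite /g jD ?fD ?jZ ?fZ//; try exact: NZ.
move: h2; rewrite /g -!rinnervv !rinnerE ReD ReZ (rinnerC (j y) (j (x k))) => h2 h3.
have h4 : `|2 * t * (rinner (j (x k)) (j y) - L)| <= e / 2.
  rewrite /L (rinnerC (j y)) -rinnerNl -rinnerDl !normrM.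
  apply: (@le_trans _ _ (2 * `|t| * (r * rnorm (j y)))).
    rewrite ger0_norm//; apply: ler_wpM2l; first by rewrite mulr_ge0.
    apply: le_trans (rinner_CauchySchwarz _ _) _.
    by apply: ler_wpM2r; [exact: rnorm_ge0|exact: ltW].
  have -> : e / 2 = r * (1 + 2 * `|t| * rnorm (j y)).
    by rewrite /r; field; rewrite lt0r_neq0.
  by nra.
move: h4; rewrite ler_norml => /andP[h4 h5]; lra.
Qed.

(** Since z lies in the closure of the image of j, evaluating f at x with j x close to z gives |z|^2
    <= K |z| up to an arbitrarily small error. *)
Lemma riesz_le (T : lmodType R[i]) (N : set T) (j : T -> H) (f : T -> R[i]) (K : R) :
  0 <= K -> N 0 -> (forall c x y, N x -> N y -> N (c *: x + y)) ->
  (forall c x y, N x -> N y -> j (c *: x + y) = c *: j x + j y) ->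
  (forall c x y, N x -> N y -> f (c *: x + y) = c * f x + f y) ->
  (forall x, N x -> rnorm (f x) <= K * rnorm (j x)) ->
  exists z : H, rnorm z <= K /\ (forall x, N x -> f x = inner (j x) z).
Proof.
move=> K0 N0 Nl jl fl fK; have [z [zN fz]] := riesz N0 Nl jl fl fK.
exists z; split=> //; have [->//|n0] := eqVneq (rnorm z) 0.
have n1 : 0 < rnorm z by rewrite lt_def n0 rnorm_ge0.
rewrite -(ler_pM2r n1) -expr2; apply: squeeze_le => e e0.
have p0 : 0 < K + rnorm z by rewrite ltr_wpDl.
have [|x Nx xz] := zN (e / (K + rnorm z)); first by rewrite divr_gt0.
move: xz; rewrite ltr_pdivlMr// => xz.
have := fK _ Nx; rewrite fz// => h1.
have := ler_Re_rnorm (inner (j x) z); rewrite ler_norml => /andP[_].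
rewrite -/(rinner _ _) => h2.
have E : rinner (j x) z = rinner (j x - z) z + rnorm z ^+ 2.
  by rewrite -rinnervv -rinnerDl subrK.
have := rinner_CauchySchwarz (j x - z) z; rewrite ler_norml => /andP[h3 _].
have := ler_rnormD (j x - z) z; rewrite subrK => h4.
have := ler_wpM2l K0 h4; lra.
Qed.

End Inner.

(** * Bounded operators, adjoints, commutants and weak closures *)

Section BoundedOperators.
Context {R : realType} {H : hilbertType R}.
Implicit Types (u v w : H) (c z : R[i]) (a b x y p : H -> H) (A M V : set (H -> H)).

Lemma op_linE c a b v : (c *: a + b) v = c *: a v + b v.
Proof. by []. Qed.

Lemma bounded_opP a : bounded_op a <->
  linear a /\ exists2 K : R, 0 <= K & forall v, rnorm (a v) <= K * rnorm v.
Proof.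
split=> [[la [C aC]]|[la [K K0 aK]]].
  split=> //; exists `|complex.Re C|; first exact: normr_ge0.
  move=> v; have := aC v; rewrite !rnormE lecE /= => /andP[_].
  rewrite mulrC ReZ mulrC => h; apply: le_trans h _.
  by rewrite ler_wpM2r ?rnorm_ge0// ler_norm.
by split=> //; exists K%:C => v; rewrite !rnormE -rmorphM lecR.
Qed.

Lemma bounded_linear a : bounded_op a -> linear a.
Proof. by case. Qed.

Lemma bounded_op_id : bounded_op (idfun : H -> H).
Proof. by apply/bounded_opP; split=> //; exists 1 => // v; rewrite mul1r. Qed.

Lemma bounded_op_lin c a b : bounded_op a -> bounded_op b -> bounded_op (c *: a + b).
Proof.
move=> /bounded_opP[la [K K0 aK]] /bounded_opP[lb [L L0 bL]]; apply/bounded_opP; split.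
  move=> d u v; rewrite !op_linE la lb !scalerDr !scalerA mulrC -!addrA.
  by congr (_ + _); rewrite addrCA.
exists (rnorm c * K + L); first by rewrite addr_ge0 ?mulr_ge0 ?rnorm_ge0.
move=> v; rewrite op_linE; apply: le_trans (ler_rnormD _ _) _.
rewrite rnormZ mulrDl lerD// -mulrA; apply: ler_wpM2l => //; exact: rnorm_ge0.
Qed.

Lemma bounded_opB a b : bounded_op a -> bounded_op b -> bounded_op (a - b).
Proof.
move=> ba bb; have -> : a - b = (-1) *: b + a; last exact: bounded_op_lin.
by apply/funext => v; rewrite op_linE scaleN1r addrC.
Qed.

Lemma adjoint_sym a b : is_adjoint a b -> is_adjoint b a.
Proof. by move=> ab v w; rewrite innerC -ab -innerC. Qed.

Lemma adjoint_uniq a b x : is_adjoint a b -> is_adjoint a x -> b = x.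
Proof. by move=> ab ax; apply/funext => v; apply: eq_inner_r => w; rewrite -ab ax. Qed.

Lemma adjoint_lin c a b x y : is_adjoint a x -> is_adjoint b y ->
  is_adjoint (c *: a + b) (c^*%C *: x + y).
Proof.
move=> ax By v w; rewrite !op_linE innerDl innerZl innerDr innerZr conjcK.
by rewrite ax By.
Qed.

Lemma adjoint_real (t : R) a b : is_adjoint a a -> is_adjoint b b ->
  is_adjoint (t%:C *: a + b) (t%:C *: a + b).
Proof. by move=> sa sb; have := adjoint_lin t%:C sa sb; rewrite conjc_real. Qed.

Lemma rinner_adj a b v w : is_adjoint a b -> rinner (a v) w = rinner v (b w).
Proof. by move=> ab; rewrite /rinner ab. Qed.

Lemma selfadjoint_inner_real a v : is_adjoint a a -> inner (a v) v = (rinner (a v) v)%:C.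
Proof.
move=> sa; rewrite /rinner RRe_real// CrealE; apply/eqP.
by rewrite [in RHS]sa [in RHS]innerC.
Qed.

Lemma adjoint_exists a : bounded_op a -> exists2 b, bounded_op b & is_adjoint a b.
Proof.
move=> ba; have /bounded_opP[la [K K0 aK]] := ba.
have /choice[b bP] : forall w : H, exists z : H, forall v, inner (a v) w = inner v z.
  move=> w; have [||||v _|z [_ zP]] := @riesz R H H setT idfun (fun v => inner (a v) w) (K * rnorm w).
  - by [].
  - by [].
  - by [].
  - by move=> c u v _ _; rewrite la innerDl innerZl.
  - apply: le_trans (inner_CauchySchwarz _ _) _; rewrite mulrAC.
    by apply: ler_wpM2r; [exact: rnorm_ge0|exact: aK].
  - by exists z => v; exact: zP.
have lb : linear b.
  by move=> c u v; apply: eq_inner_r => w; rewrite -bP !innerDr !innerZr !bP.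
exists b => //; apply/bounded_opP; split=> //; exists K => // v.
have [->|n0] := eqVneq (rnorm (b v)) 0; first by rewrite mulr_ge0 ?rnorm_ge0.
have n1 : 0 < rnorm (b v) by rewrite lt_def n0 rnorm_ge0.
rewrite -(ler_pM2l n1) -expr2 -rinnervv /rinner -bP.
apply: le_trans (ler_norm _) _; apply: le_trans (rinner_CauchySchwarz _ _) _.
by rewrite mulrA (mulrC _ K) ler_wpM2r ?rnorm_ge0.
Qed.

Lemma commutant_adjoint A b x : (forall a, A a -> exists2 a', A a' & is_adjoint a a') ->
  commutant A b -> bounded_op x -> is_adjoint b x -> commutant A x.
Proof.
move=> Astar [bb bA] bx adj; split=> // a Aa; have [a' Aa' aa'] := Astar _ Aa.
apply: ext_inner => v w /=; rewrite aa' !(adjoint_sym adj) aa'.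
by have := bA _ Aa' => /(congr1 (fun f => f w)) /= ->.
Qed.

(** p u is the Riesz representative of v |-> <v, u> on V; [riesz] places it in the closure of V,
    hence in V. *)
Lemma closed_subspace_projection (V : set H) : V 0 ->
    (forall c u v, V u -> V v -> V (c *: u + v)) ->
    (forall u, (forall e : R, 0 < e -> exists2 v, V v & rnorm (v - u) < e) -> V u) ->
  exists p, [/\ bounded_op p, p \o p = p, is_adjoint p p & forall u, V u <-> p u = u].
Proof.
move=> V0 Vlin Vcl.
have /choice[p pP] : forall u : H, exists z : H, V z /\ forall v, V v -> inner v u = inner v z.
  move=> u; have [||||v _|z [zV zP]] := @riesz R H H V idfun (fun v => inner v u) (rnorm u) => //.
  - by move=> c v w _ _; rewrite innerDl innerZl.
  - by rewrite mulrC inner_CauchySchwarz.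
  - by exists z; split=> //; exact: Vcl.
have pV u : V u -> p u = u.
  move=> Vu; have [Vp pu] := pP u.
  have Vd : V (p u - u) by rewrite addrC -scaleN1r; exact: Vlin.
  have := pu _ Vd => /eqP; rewrite -subr_eq0 -innerNr -innerDr => /eqP h.
  apply/eqP; rewrite -subr_eq0; apply/eqP; apply: rnorm_eq0; apply/eqP.
  rewrite -sqrf_eq0 -rinnervv /rinner -[X in inner _ X]opprK innerNr opprB h oppr0.
  by [].
have pp u v : inner (p u) v = inner u (p v).
  rewrite ((pP v).2 _ (pP u).1) innerC -((pP u).2 _ (pP v).1).
  by rewrite -innerC.
have lp : linear p.
  by move=> c u v; apply: eq_inner => w; rewrite pp !innerDl !innerZl !pp.
have pVu u : V (p u) := (pP u).1.
exists p; split=> //.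
- apply/bounded_opP; split=> //; exists 1 => // v; rewrite mul1r.
  have [->|n0] := eqVneq (rnorm (p v)) 0; first exact: rnorm_ge0.
  have n1 : 0 < rnorm (p v) by rewrite lt_def n0 rnorm_ge0.
  rewrite -(ler_pM2l n1) -expr2 -rinnervv /rinner pp (pV (p v))//.
  rewrite mulrC; apply: le_trans (ler_norm _) _; exact: rinner_CauchySchwarz.
- by apply/funext => u /=; exact: pV.
- by move=> u; split=> [/pV|<-].
Qed.

(** Invariance of V under b gives p b p = b p; invariance under its adjoint x gives p b p = p b. *)
Lemma projection_commute (V : set H) p b x : is_adjoint p p -> p \o p = p ->
    (forall u, V u <-> p u = u) -> is_adjoint b x ->
    (forall u, V u -> V (b u)) -> (forall u, V u -> V (x u)) ->
  b \o p = p \o b.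
Proof.
move=> sp pp pV bx Vb Vx; have ppu u : p (p u) = p u by rewrite -[LHS]/((p \o p) u) pp.
have pVu u : V (p u) by apply/pV.
apply: ext_inner => u v /=.
have /pV {1}<- := Vb _ (pVu u); rewrite [LHS]sp [LHS]bx [LHS]sp.
by have /pV -> := Vx _ (pVu v); rewrite [RHS]sp [RHS]bx.
Qed.

Lemma vn_star M : von_neumann_algebra M -> star_subalgebra M.
Proof. by case. Qed.

Lemma star_bounded A a : star_subalgebra A -> A a -> bounded_op a.
Proof. by case=> Ab _ _ _; exact: Ab. Qed.

Lemma star_linear A a : star_subalgebra A -> A a -> linear a.
Proof. by move=> sA /(star_bounded sA)[]. Qed.

Lemma star_comp A a b : star_subalgebra A -> A a -> A b -> A (a \o b).
Proof. by case=> _ _ Ac _; exact: Ac. Qed.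

Lemma star0 A : star_subalgebra A -> A 0.
Proof. by case=> _ []. Qed.

Lemma star_lin A c a b : star_subalgebra A -> A a -> A b -> A (c *: a + b).
Proof. by case=> _ [_ Al] _ _; exact: Al. Qed.

Lemma starZ A c a : star_subalgebra A -> A a -> A (c *: a).
Proof.
move=> sA Aa; rewrite (_ : c *: a = c *: a + 0); first exact: star_lin (star0 sA).
by apply/funext => v; rewrite op_linE addr0.
Qed.

Lemma starD A a b : star_subalgebra A -> A a -> A b -> A (fun v => a v + b v).
Proof.
move=> sA Aa Ab; rewrite (_ : (fun _ => _) = 1 *: a + b); first exact: star_lin.
by apply/funext => v; rewrite op_linE scale1r.
Qed.

Lemma starB A a b : star_subalgebra A -> A a -> A b -> A (fun v => a v - b v).
Proof.
move=> sA Aa Ab; rewrite (_ : (fun _ => _) = (-1) *: b + a); first exact: star_lin.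
by apply/funext => v; rewrite op_linE scaleN1r addrC.
Qed.

Lemma star_adjoint A a b : star_subalgebra A -> A a -> is_adjoint a b -> A b.
Proof. by case=> _ _ _ As /As[x Ax ax] /(adjoint_uniq ax) <-. Qed.

Lemma vn_mem M a : von_neumann_algebra M -> bounded_op a ->
  (forall b, commutant M b -> b \o a = a \o b) -> M a.
Proof. by move=> [_ MM] ba ab; rewrite -MM; split. Qed.

Lemma vn_id M : von_neumann_algebra M -> M idfun.
Proof. by move=> vM; apply: (vn_mem vM) => //; exact: bounded_op_id. Qed.

(** The commutant M' is closed under adjoints, so its elements commute with the projection onto V,
    which then lies in M'' = M. *)
Lemma vn_subspace_projection M (V : set H) : von_neumann_algebra M -> V 0 ->
    (forall c u v, V u -> V v -> V (c *: u + v)) ->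
    (forall u, (forall e : R, 0 < e -> exists2 v, V v & rnorm (v - u) < e) -> V u) ->
    (forall b, commutant M b -> forall v, V v -> V (b v)) ->
  exists p, projection_in M p /\ forall u, V u <-> p u = u.
Proof.
move=> vM V0 Vlin Vcl Vinv.
have [p [bp pp sp pV]] := closed_subspace_projection V0 Vlin Vcl.
exists p; split=> //; split=> //; apply: vn_mem => // b Mb.
have [x bx adj] := adjoint_exists Mb.1.
apply: (projection_commute sp pp pV adj); first exact: Vinv.
by apply: Vinv; apply: commutant_adjoint Mb bx adj; case: vM => [[]].
Qed.

(** A difference of two matrix coefficients is weakly continuous, so its zero set is closed. *)
Lemma wot_closure_inner A a u v w (z : H) : wot_closure A a ->
  (forall b, A b -> inner (b u) v = inner (b w) z) -> inner (a u) v = inner (a w) z.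
Proof.
move=> [_ Aa] Aeq.
have coef (s t : H) : continuous ((fun b => inner (b s) t) : @wot R H -> R[i]^o).
  move=> b; have h1 := @initial_continuous _ _ (@matrix_coefficients R H) b.
  have h2 := @proj_continuous (H * H)%type (fun=> R[i]^o) (s, t) (matrix_coefficients b).
  exact: cvg_comp h1 h2.
pose F := (fun b => inner (b u) v - inner (b w) z) : @wot R H -> R[i]^o.
have cF : continuous F by move=> b; exact: (cvgB (@coef u v b) (@coef w z b)).
apply/eqP; rewrite -subr_eq0 -normr_le0; apply: contraT => Fa.
have Fa0 : 0 < `|F a| by rewrite normr_gt0; move: Fa; rewrite normr_le0.
have /cvgrPdist_lt /(_ _ Fa0) /Aa [b [Ab]] := cF a.
by rewrite /F /= (Aeq b Ab) subrr subr0 ltxx.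
Qed.

End BoundedOperators.

(** * Norm limits of sequences of vectors, with real tolerances *)

Section StrongLimits.
Context {R : realType} {H : hilbertType R}.
Implicit Types (u v w : H) (c : R[i]) (a b : H -> H) (f g : nat -> H).

Definition slim f (z : H) : Prop :=
  forall e : R, 0 < e -> exists n, forall k, (n <= k)%N -> rnorm (f k - z) < e.

Lemma slim_const z : slim (fun=> z) z.
Proof. by move=> e e0; exists 0%N => k _; rewrite subrr rnorm0. Qed.

Lemma slim_shift f z : slim f z -> slim (fun k => f k.+1) z.
Proof. by move=> fz e /fz[n nP]; exists n => k nk; apply: nP; exact: leqW. Qed.

Lemma slim_lin c f g (y z : H) : slim f y -> slim g z -> slim (fun k => c *: f k + g k) (c *: y + z).
Proof.
move=> fy gz e e0; have c0 : 0 < 1 + rnorm c by rewrite ltr_wpDr ?rnorm_ge0.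
have [|n nP] := fy (e / 2 / (1 + rnorm c)); first by rewrite !divr_gt0.
have [|m mP] := gz (e / 2); first by rewrite divr_gt0.
exists (maxn n m) => k; rewrite geq_max => /andP[nk mk].
rewrite opprD addrACA -scalerBr; apply: le_lt_trans (ler_rnormD _ _) _.
rewrite rnormZ; have := mP _ mk; have := nP _ nk; rewrite ltr_pdivlMr//.
have := rnorm_ge0 (f k - y); have := rnorm_ge0 c; nra.
Qed.

Lemma slim_inner f g u v (y z : H) : slim f y -> slim g z ->
  (forall k, inner (f k) u = inner v (g k)) -> inner y u = inner v z.
Proof.
move=> fy gz fg; apply/eqP; rewrite -subr_eq0; apply/eqP; apply: rnorm_eq0.
apply/eqP; rewrite eq_le rnorm_ge0 andbT; apply: squeeze_le => e e0; rewrite add0r.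
have p0 : 0 < 1 + rnorm u + rnorm v by rewrite -addrA ltr_wpDr ?addr_ge0 ?rnorm_ge0.
pose r := e / (1 + rnorm u + rnorm v); have r0 : 0 < r by rewrite divr_gt0.
have [n nP] := fy _ r0; have [m mP] := gz _ r0.
have h1 := nP _ (leq_maxl n m); have h2 := mP _ (leq_maxr n m).
set k := maxn n m in h1 h2.
have -> : inner y u - inner v z = - inner (f k - y) u + inner v (g k - z).
  by rewrite innerDl innerDr innerNl innerNr fg; ring.
apply: le_trans (ler_rnormD _ _) _; rewrite rnormN.
have er : e = r * (1 + rnorm u + rnorm v) by rewrite /r; field; rewrite lt0r_neq0.
have := inner_CauchySchwarz (f k - y) u; have := inner_CauchySchwarz v (g k - z).
have := rnorm_ge0 u; have := rnorm_ge0 v; rewrite er; nra.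
Qed.

Lemma slim_uniq f (y z : H) : slim f y -> slim f z -> y = z.
Proof.
move=> fy fz; apply/eqP; rewrite -subr_eq0; apply/eqP; apply: rnorm_eq0.
apply/eqP; rewrite eq_le rnorm_ge0 andbT; apply: squeeze_le => e e0; rewrite add0r.
have e2 : 0 < e / 2 by rewrite divr_gt0.
have [n nP] := fy _ e2; have [m mP] := fz _ e2.
have h1 := nP _ (leq_maxl n m); have h2 := mP _ (leq_maxr n m).
set k := maxn n m in h1 h2.
have -> : y - z = - (f k - y) + (f k - z) by rewrite opprB addrA subrK.
by apply: le_trans (ler_rnormD _ _) _; rewrite rnormN; lra.
Qed.

Lemma slim_le f z (K : R) : slim f z -> (forall k, rnorm (f k) <= K) -> rnorm z <= K.
Proof.
move=> fz fK; apply: squeeze_le => e /fz[n /(_ n (leqnn n)) nP].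
have -> : z = f n - (f n - z) by rewrite opprB addrCA subrr addr0.
by apply: le_trans (ler_rnormD _ _) _; rewrite rnormN; have := fK n; lra.
Qed.

Lemma slim_op f z b : bounded_op b -> slim f z -> slim (fun k => b (f k)) (b z).
Proof.
move=> /bounded_opP[lb [K K0 bK]] fz e e0.
have K1 : 0 < 1 + K by rewrite ltr_wpDr.
have [|n nP] := fz (e / (1 + K)); first by rewrite divr_gt0.
exists n => k nk; have := nP _ nk; rewrite ltr_pdivlMr// -linB//.
have := bK (f k - z); have := rnorm_ge0 (f k - z); nra.
Qed.

End StrongLimits.

(** * Square roots of positive contractions *)

Section SquareRoot.
Context {R : realType} {H : hilbertType R}.
Implicit Types (u v w : H) (c : R[i]) (a b y p : H -> H).
Variable x : H -> H.
Hypotheses (lx : linear x) (sx : is_adjoint x x).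
Hypotheses (x_ge0 : forall v, 0 <= rinner (x v) v) (x_le1 : forall v, rnorm (x v) <= rnorm v).

(** Polynomials in x with nonnegative coefficients. They are stable under sums and products, and
    each is a positive operator because the powers of x are; exhibiting differences of iterates in
    this class makes the iteration monotone. *)
Inductive npoly : (H -> H) -> Prop :=
| npoly0 : npoly (fun=> 0)
| npolyS k (t : R) y : 0 <= t -> npoly y -> npoly (fun v => t%:C *: iter k x v + y v).

Lemma npolyD y z : npoly y -> npoly z -> npoly (fun v => y v + z v).
Proof.
move=> + nz; elim=> [|k t {}y t0 _ IH].
  by rewrite (_ : (fun _ => _) = z)//; apply/funext => v; rewrite add0r.
rewrite (_ : (fun _ => _) = fun v => t%:C *: iter k x v + (y v + z v)); first exact: npolyS.
by apply/funext => v; rewrite addrA.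
Qed.

Lemma npolyZ (t : R) y : 0 <= t -> npoly y -> npoly (fun v => t%:C *: y v).
Proof.
move=> t0; elim=> [|k s {}y s0 _ IH].
  rewrite (_ : (fun _ => _) = fun=> 0); first exact: npoly0.
  by apply/funext => v; exact: scaler0.
rewrite (_ : (fun _ => _) = fun v => (t * s)%:C *: iter k x v + t%:C *: y v).
  by apply: npolyS => //; exact: mulr_ge0.
by apply/funext => v; rewrite scalerDr rmorphM -scalerA.
Qed.

Lemma iter_lin k : linear (iter k x).
Proof. by elim: k => [//|k IH] c u v; rewrite !iterS IH lx. Qed.

Lemma npoly_iter k y : npoly y -> npoly (fun v => iter k x (y v)).
Proof.
elim=> [|l s {}y s0 _ IH].
  rewrite (_ : (fun _ => _) = fun=> 0); first exact: npoly0.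
  by apply/funext => v; rewrite (lin0 (iter_lin k)).
rewrite (_ : (fun _ => _) = fun v => s%:C *: iter (k + l) x v + iter k x (y v)).
  exact: npolyS.
by apply/funext => v; rewrite (iter_lin k s%:C) -iterD.
Qed.

Lemma npoly_comp y z : npoly y -> npoly z -> npoly (fun v => y (z v)).
Proof.
move=> + nz; elim=> [|l s {}y s0 _ IH]; first exact: npoly0.
by apply: npolyD => //; apply: npolyZ => //; exact: npoly_iter.
Qed.

Lemma npoly_x : npoly x.
Proof.
rewrite (_ : x = fun v => 1%:C *: iter 1 x v + 0); first by apply: npolyS => //; exact: npoly0.
by apply/funext => v; rewrite addr0 scale1r.
Qed.

Lemma npoly_lin y : npoly y -> linear y.
Proof.
elim=> [|l s {}y s0 _ IH] c u v; first by rewrite scaler0 addr0.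
rewrite (iter_lin l c) IH !scalerDr !scalerA mulrC -!addrA.
by congr (_ + _); rewrite addrCA.
Qed.

Lemma iter_adj k : is_adjoint (iter k x) (iter k x).
Proof. by elim: k => [//|k IH] u v; rewrite iterS sx IH -iterSr. Qed.

Lemma npoly_adj y : npoly y -> is_adjoint y y.
Proof.
elim=> [|l s {}y s0 _ IH]; first by move=> u v; rewrite inner0l inner0r.
by move=> u v; rewrite innerDl innerZl innerDr innerZr conjc_real (iter_adj l) IH.
Qed.

(** Even powers give |x^m v|^2, odd ones <x (x^m v), x^m v>. *)
Lemma iter_ge0 k v : 0 <= rinner (iter k x v) v.
Proof.
rewrite -(odd_double_half k) -addnn addnA iterD (rinner_adj _ _ (iter_adj _)).
case: (odd k); first by rewrite add1n iterS -(rinner_adj _ _ sx).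
by rewrite add0n rinnervv sqr_ge0.
Qed.

Lemma npoly_ge0 y v : npoly y -> 0 <= rinner (y v) v.
Proof.
elim=> [|l s {}y s0 _ IH]; first by rewrite rinner0l.
by rewrite rinnerDl rinnerZl addr_ge0// mulr_ge0// iter_ge0.
Qed.

Lemma npoly_commute y b : linear b -> x \o b = b \o x -> npoly y -> y \o b = b \o y.
Proof.
move=> lb xb; have xbv v : x (b v) = b (x v) by rewrite -[LHS]/((x \o b) v) xb.
have ib k v : iter k x (b v) = b (iter k x v) by elim: k => // k IH; rewrite !iterS IH xbv.
elim=> [|l s {}y s0 _ IH]; apply/funext => v /=; first by rewrite (lin0 lb).
rewrite ib linD// linZ//; congr (_ + _).
by rewrite -[LHS]/((y \o b) v) IH.
Qed.

(* The iteration y -> (x + y^2) / 2 increases to y = 1 - sqrt (1 - x). *)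
Fixpoint sqrt_iter n : H -> H :=
  if n is m.+1 then fun v => (2^-1)%:C *: (x v + sqrt_iter m (sqrt_iter m v)) else fun=> 0.

Let half_ge0 : 0 <= 2^-1 :> R. Proof. by rewrite invr_ge0. Qed.

Lemma sqrt_iterSE n v : sqrt_iter n.+1 v = (2^-1)%:C *: (x v + sqrt_iter n (sqrt_iter n v)).
Proof. by []. Qed.

Lemma npoly_sqrt_iter n : npoly (sqrt_iter n).
Proof.
elim: n => [|n IH]; first exact: npoly0.
by apply: npolyZ => //; apply: npolyD; [exact: npoly_x|exact: npoly_comp].
Qed.

Lemma sqrt_iter_step n :
  exists2 d, npoly d & forall v, sqrt_iter n.+1 v = sqrt_iter n v + d v.
Proof.
elim: n => [|n [d nd IH]].
  by exists (sqrt_iter 1); [exact: npoly_sqrt_iter|move=> v; rewrite [RHS]add0r].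
have ny := npoly_sqrt_iter n.
(* If y_{n+1} = y_n + d, the next increment is (y_{n+1}^2 - y_n^2) / 2 = (y_n d + d y_n + d^2) /
   2. *)
exists (fun v => (2^-1)%:C *: (sqrt_iter n (d v) + (d (sqrt_iter n v) + d (d v)))).
  by apply: npolyZ => //; apply: npolyD; [exact: npoly_comp|apply: npolyD; exact: npoly_comp].
move=> v; rewrite [in LHS]sqrt_iterSE [in RHS]sqrt_iterSE -scalerDr; congr (_ *: _).
rewrite !IH (linD (npoly_lin ny)) (linD (npoly_lin nd)) -!addrA.
by congr (_ + (_ + _)).
Qed.

Lemma sqrt_iter_diff n m :
  exists2 d, npoly d & forall v, sqrt_iter (n + m) v = sqrt_iter n v + d v.
Proof.
elim: m => [|m [d nd IH]].
  by exists (fun=> 0); [exact: npoly0|move=> v; rewrite addn0 addr0].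
rewrite addnS; have [d' nd' E] := sqrt_iter_step (n + m).
by exists (fun v => d v + d' v); [exact: npolyD|move=> v; rewrite E IH addrA].
Qed.

Lemma sqrt_iter_le1 n v : rnorm (sqrt_iter n v) <= rnorm v.
Proof.
elim: n v => [|n IH] v; first by rewrite rnorm0 rnorm_ge0.
rewrite sqrt_iterSE rnormZ rnorm_real//.
have := ler_rnormD (x v) (sqrt_iter n (sqrt_iter n v)); have := x_le1 v.
have := le_trans (IH _) (IH v); lra.
Qed.

(** The difference d of the iterates satisfies 0 <= d <= 1. Cauchy-Schwarz for the form of d, at v
    and d v, gives |d v|^4 <= <d v, v> <d (d v), d v> <= <d v, v> |d v|^2. *)
Lemma sqrt_iter_cauchy n m v : rnorm (sqrt_iter (n + m) v - sqrt_iter n v) ^+ 2 <=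
  rinner (sqrt_iter (n + m) v) v - rinner (sqrt_iter n v) v.
Proof.
have [d nd E] := sqrt_iter_diff n m.
have dE u : d u = sqrt_iter (n + m) u - sqrt_iter n u by rewrite E addrC addKr.
rewrite -rinnerNl -rinnerDl -dE.
have := psd_CauchySchwarz (npoly_lin nd)
  (fun u w => rinner_adj u w (npoly_adj nd)) (fun u => npoly_ge0 u nd) v (d v).
rewrite rinnervv; set D := rnorm (d v) ^+ 2.
have : rinner (d (d v)) (d v) <= D.
  rewrite {1}dE rinnerDl rinnerNl.
  have := npoly_ge0 (d v) (npoly_sqrt_iter n).
  have := rinner_CauchySchwarz (sqrt_iter (n + m) (d v)) (d v).
  rewrite ler_norml => /andP[_].
  have := sqrt_iter_le1 (n + m) (d v); have := rnorm_ge0 (d v); rewrite /D; nra.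
have := npoly_ge0 v nd; have : 0 <= D by exact: sqr_ge0.
rewrite le_eqVlt => /orP[/eqP <- //|D0] h0 h1 h2.
rewrite -(ler_pM2r D0) -expr2; apply: le_trans h2 _; exact: ler_wpM2l.
Qed.

(** The numbers <y_n v, v> are bounded by |v|^2, and [sqrt_iter_cauchy] turns closeness to their
    supremum into a Cauchy estimate. *)
Lemma sqrt_iter_lim v : exists z, slim (fun n => sqrt_iter n v) z.
Proof.
apply: complete_seq => e e0.
pose s n := rinner (sqrt_iter n v) v.
have hs : has_sup (range s).
  split; first by exists (s 0%N), 0%N.
  exists (rnorm v ^+ 2) => _ [n _ <-]; have := rinner_CauchySchwarz (sqrt_iter n v) v.
  rewrite ler_norml => /andP[_]; have := sqrt_iter_le1 n v; have := rnorm_ge0 v.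
  by rewrite /s; nra.
have e4 : 0 < e ^+ 2 / 4 by rewrite divr_gt0 ?exprn_gt0.
have [_ [n _ <-] sn] := sup_adherent e4 hs.
have bd k : (n <= k)%N -> rnorm (sqrt_iter k v - sqrt_iter n v) < e / 2.
  move=> nk; rewrite -(ltr_pXn2r (n := 2))// ?nnegrE ?rnorm_ge0 ?divr_ge0 ?ltW//.
  have := sqrt_iter_cauchy n (k - n) v; rewrite subnKC// => h.
  have sk : s k <= sup (range s) by apply: ub_le_sup; [case: hs|exists k].
  apply: le_lt_trans h _; rewrite expr_div_n.
  have -> : 2 ^+ 2 = 4 :> R by rewrite -natrX.
  by move: sk sn; rewrite /s; lra.
exists n => k l nk nl.
have -> : sqrt_iter k v - sqrt_iter l v =
    (sqrt_iter k v - sqrt_iter n v) - (sqrt_iter l v - sqrt_iter n v).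
  by rewrite opprB addrA subrK.
apply: le_lt_trans (ler_rnormD _ _) _; rewrite rnormN.
by have := bd _ nk; have := bd _ nl; lra.
Qed.

(** The equation 2 y = x + y^2 says (1 - y)^2 = 1 - x. Commutation is inherited from the iterates,
    which are polynomials in x. *)
Lemma sqrt_compl : exists y, [/\ bounded_op y, is_adjoint y y,
  forall v, rnorm (y v) <= rnorm v, forall v, y v + y v = x v + y (y v)
  & forall b, bounded_op b -> x \o b = b \o x -> y \o b = b \o y].
Proof.
have /choice[y yP] := sqrt_iter_lim.
have y1 v : rnorm (y v) <= rnorm v.
  by apply: slim_le (yP v) _ => k; exact: sqrt_iter_le1.
have ly : linear y.
  move=> c u v; apply: (slim_uniq (yP _)).
  have := slim_lin c (yP u) (yP v); congr slim; apply/funext => k.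
  by rewrite (npoly_lin (npoly_sqrt_iter k)).
exists y; split=> //.
- by apply/bounded_opP; split=> //; exists 1 => // v; rewrite mul1r.
- move=> u v; apply: slim_inner (yP u) (yP v) _ => k.
  exact: (npoly_adj (npoly_sqrt_iter k)).
(* The iterates are contractions, and under a uniform bound the product of strong limits is the
   limit of the products. *)
- move=> v; have yy : slim (fun k => sqrt_iter k (sqrt_iter k v)) (y (y v)).
    move=> e e0; have e2 : 0 < e / 2 by rewrite divr_gt0.
    have [n nP] := yP v _ e2; have [m mP] := yP (y v) _ e2.
    exists (maxn n m) => k; rewrite geq_max => /andP[nk mk].
    have -> : sqrt_iter k (sqrt_iter k v) - y (y v) =
        sqrt_iter k (sqrt_iter k v - y v) + (sqrt_iter k (y v) - y (y v)).
      by rewrite (linB (npoly_lin (npoly_sqrt_iter k))) addrA subrK.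
    apply: le_lt_trans (ler_rnormD _ _) _.
    have := sqrt_iter_le1 k (sqrt_iter k v - y v).
    by have := nP _ nk; have := mP _ mk; lra.
  have h1 := slim_lin (2^-1)%:C (slim_lin 1 (slim_const (x v)) yy) (slim_const 0).
  have h2 : slim (fun k => sqrt_iter k.+1 v) ((2^-1)%:C *: (1 *: x v + y (y v)) + 0).
    by move: h1; congr slim; apply/funext => k; rewrite addr0 scale1r.
  have yvE := slim_uniq (slim_shift (yP v)) h2; rewrite scale1r addr0 in yvE.
  rewrite {1 2}yvE -scalerDl -rmorphD /=.
  have -> : 2^-1 + 2^-1 = 1 :> R by field.
  exact: scale1r.
- move=> b bb xb; apply/funext => v; apply: (slim_uniq (yP (b v))).
  have := slim_op bb (yP v); congr slim; apply/funext => k /=.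
  by have /(congr1 (fun f => f v)) /= -> :=
    npoly_commute (bounded_linear bb) xb (npoly_sqrt_iter k).
Qed.

End SquareRoot.

(** * Absolute values and positive spectral projections *)

Section Hahn.
Context {R : realType} {H : hilbertType R}.
Implicit Types (u v w : H) (c : R[i]) (a b y p : H -> H) (M : set (H -> H)).

(** B is |a|: for x = 1 - a^2 and the y of [sqrt_compl], (1 - y)^2 = 1 - x = a^2. *)
Lemma contraction_abs a : bounded_op a -> is_adjoint a a ->
    (forall v, rnorm (a v) <= rnorm v) ->
  exists B, [/\ bounded_op B, is_adjoint B B, forall v, 0 <= rinner (B v) v,
    forall v, B (B v) = a (a v)
    & forall b, bounded_op b -> a \o b = b \o a -> B \o b = b \o B].
Proof.
move=> ba sa a1; have la := bounded_linear ba.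
pose x : H -> H := idfun - (a \o a).
have xE v : x v = v - a (a v) by [].
have lx : linear x.
  by move=> c u v; rewrite !xE !la scalerBr opprD addrACA.
have sx : is_adjoint x x.
  by move=> u v; rewrite !xE innerDl innerNl innerDr innerNr !sa.
have xvv v : rinner (x v) v = rnorm v ^+ 2 - rnorm (a v) ^+ 2.
  by rewrite xE rinnerDl rinnerNl (rinner_adj _ _ sa) !rinnervv.
have x0 v : 0 <= rinner (x v) v.
  by rewrite xvv subr_ge0 ler_pXn2r ?nnegrE ?rnorm_ge0.
have x1 v : rnorm (x v) <= rnorm v.
  rewrite -(ler_pXn2r (n := 2)) ?nnegrE ?rnorm_ge0// -!rinnervv.
  rewrite {2}xE rinnerDr rinnerNr xvv -(rinner_adj _ _ sa).
  have -> : rinner (a (x v)) (a v) = rinner (x (a v)) (a v).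
    by rewrite !xE (linB la).
  by rewrite xvv rinnervv; have := a1 (a v); have := rnorm_ge0 (a (a v));
     have := sqr_ge0 (rnorm (a v)); nra.
have [y [bounded_y sy y1 yE yc]] := sqrt_compl lx sx x0 x1.
exists (idfun - y); split.
- by apply: bounded_opB => //; exact: bounded_op_id.
- by move=> u v; rewrite /= innerDl innerDr innerNl innerNr sy.
- move=> v; rewrite /= rinnerDl rinnerNl rinnervv subr_ge0.
  have := rinner_CauchySchwarz (y v) v; rewrite ler_norml => /andP[_].
  by have := y1 v; have := rnorm_ge0 v; nra.
- move=> v; rewrite -[LHS]/((v - y v) - y (v - y v)) (linB (bounded_linear bounded_y)).
  transitivity (v - (y v + y v) + y (y v)).
    by rewrite opprB opprD !addrA addrAC.
  by rewrite yE xE opprD addrA subrK opprB addrC subrK.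
- move=> b bb ab; have lb := bounded_linear bb.
  have abv v : a (b v) = b (a v) by rewrite -[LHS]/((a \o b) v) ab.
  have xb : x \o b = b \o x by apply/funext => v /=; rewrite !xE linB// !abv.
  apply/funext => v /=; rewrite linB//; congr (_ - _).
  by rewrite -[LHS]/((y \o b) v) yc.
Qed.

(* The positive spectral subspace is the kernel of |a| - a. *)
Lemma vn_hahn M a : von_neumann_algebra M -> M a -> is_adjoint a a ->
  exists p, [/\ projection_in M p,
    forall b, is_adjoint b b -> bounded_op b -> a \o b = b \o a -> p \o b = b \o p,
    forall v, p v = v -> 0 <= rinner (a v) v & forall v, p v = 0 -> rinner (a v) v <= 0].
Proof.
move=> vM Ma0 sa0.
(* Scaling by 1 / (1 + K) preserves the signs of the quadratic form and the operators commuting with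
   a. *)
wlog a1 : a Ma0 sa0 / forall v, rnorm (a v) <= rnorm v.
  move=> wl; have /bounded_opP[la [K K0 aK]] := star_bounded (vn_star vM) Ma0.
  have K1 : 0 < 1 + K by rewrite ltr_wpDr.
  pose t := (1 + K)^-1; have t0 : 0 < t by rewrite invr_gt0.
  have tE v : (t%:C *: a + 0) v = t%:C *: a v by rewrite op_linE addr0.
  have [||v|p [Mp pc pos neg]] := wl (t%:C *: a + 0).
  - exact: star_lin (vn_star vM) Ma0 (star0 (vn_star vM)).
  - by apply: adjoint_real => // u v; rewrite inner0l inner0r.
  - rewrite tE rnormZ (rnorm_real (ltW t0)) ler_pdivrMl//.
    by have := aK v; have := rnorm_ge0 v; nra.
  exists p; split=> //.
  - move=> b sb bb ab; apply: pc => //; apply/funext => v /=; rewrite !tE (linZ (bounded_linear bb)).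
    by have /(congr1 (fun f => f v)) /= -> := ab.
  - by move=> v /pos; rewrite tE rinnerZl pmulr_rge0.
  - by move=> v /neg; rewrite tE rinnerZl pmulr_rle0.
have ba := star_bounded (vn_star vM) Ma0; have la := bounded_linear ba.
have [B [bB sB B0 BB Bc]] := contraction_abs ba sa0 a1.
have lB := bounded_linear bB.
have Bab v : B (a v) = a (B v).
  by rewrite -[LHS]/((B \o a) v) Bc.
pose V := [set v | B v = a v].
have bBa := bounded_opB bB ba.
have /bounded_opP[_ [K K0 BaK]] := bBa.
have VP v : V v <-> (B - a) v = 0.
  by split=> [h|h]; [apply/eqP; rewrite subr_eq0; apply/eqP|apply/eqP; rewrite -subr_eq0; apply/eqP].
have [||||p [Mp pV]] := vn_subspace_projection (V := V) vM.
- by rewrite /V /= (lin0 lB) (lin0 la).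
- by move=> c u v Vu Vv; rewrite /V /= lB la Vu Vv.
- move=> u h; apply/VP; apply: rnorm_eq0; apply/eqP; rewrite eq_le rnorm_ge0 andbT.
  apply: squeeze_le => e e0; rewrite add0r.
  have K1 : 0 < 1 + K by rewrite ltr_wpDr.
  have [|v /VP Vv vu] := h (e / (1 + K)); first by rewrite divr_gt0.
  have := BaK (v - u); rewrite (linB (bounded_linear bBa)) Vv add0r rnormN.
  move=> h1; apply: le_trans h1 _; move: vu; rewrite ltr_pdivlMr//.
  by have := rnorm_ge0 (v - u); nra.
- move=> b [bb bM] v Vv; have ab := bM _ Ma0.
  have /(congr1 (fun f => f v)) /= := Bc b bb ab; rewrite /V /= => ->.
  by rewrite Vv; have /(congr1 (fun f => f v)) /= := ab.
have [Mp1 pp sp] := Mp.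
exists p; split=> //.
- move=> b sb bb ab; apply/esym.
  suff Vb u : V u -> V (b u) by exact: (projection_commute sp pp pV sb).
  move=> Vu; have /(congr1 (fun f => f u)) /= := Bc b bb ab; rewrite /V /= => ->.
  by rewrite Vu; have /(congr1 (fun f => f u)) /= := ab.
- by move=> v /pV <-.
(* As B (B + a) = a (B + a), the range of B + a lies in V; a vector v with p v = 0 is orthogonal to
   V, so (B + a) v = 0. *)
- move=> v pv; suff Bv : B v = - a v by have := B0 v; rewrite Bv rinnerNl oppr_ge0.
  apply: eq_inner => w; apply/eqP; rewrite -subr_eq0 innerNl opprK -innerDl.
  have : V (B w + a w) by rewrite /V /= linD// linD// BB Bab addrC.
  move=> /pV h; rewrite innerDl sB sa0 -innerDr -h -sp pv inner0l.
  by [].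
Qed.

End Hahn.

(** * Splitting projections and finding abelian ones *)

Section MinimalProjections.
Context {R : realType} {H : hilbertType R}.
Implicit Types (u v w Psi : H) (a b c e p q x y : H -> H) (A M : set (H -> H)).

Lemma projection_mem A p : projection_in A p -> A p.
Proof. by case. Qed.

Lemma projectionK A p v : projection_in A p -> p (p v) = p v.
Proof. by move=> [_ pp _]; rewrite -[LHS]/((p \o p) v) pp. Qed.

Lemma projection_neq0 p : p <> 0 -> exists v, p v <> 0.
Proof.
move=> p0; apply: contrapT => h; apply: p0; apply/funext => v.
by apply: contrapT => pv; apply: h; exists v.
Qed.

(** Cauchy-Schwarz for the form of a, at v and a v. *)
Lemma selfadjoint_eq0 a : linear a -> is_adjoint a a -> (forall v, rinner (a v) v = 0) ->
  forall v, a v = 0.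
Proof.
move=> la sa a0 v; apply: rnorm_eq0; apply/eqP; rewrite -sqrf_eq0 -rinnervv -sqrf_eq0.
rewrite eq_le sqr_ge0 andbT.
have := psd_CauchySchwarz la (fun u w => rinner_adj u w sa) _ v (a v).
by rewrite a0 mul0r; apply => w; rewrite a0.
Qed.

Lemma corner_scalar A p : star_subalgebra A -> projection_in A p ->
    (forall x, A x -> is_adjoint x x -> (forall v, p (x (p v)) = x v) ->
       exists t : R, forall v, x v = t%:C *: p v) ->
  forall a, A a -> exists z : R[i], forall v, p (a (p v)) = z *: p v.
Proof.
move=> sA pA scal a Aa; have [Ap pp sp] := pA.
have [_ _ _ /(_ _ Aa)[b Ab ab]] := sA.
have ba := adjoint_sym ab.
have la := star_linear sA Aa; have lb := star_linear sA Ab; have lp := star_linear sA Ap.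
have corner x : A x -> A (p \o (x \o p)).
  by move=> Ax; apply: (star_comp sA Ap); exact: (star_comp sA Ax Ap).
have ppv v := projectionK v pA.
have [|||s sP] := scal (p \o ((1 *: a + b) \o p)).
- exact: corner (star_lin _ sA Aa Ab).
- by move=> u v; rewrite /= sp !op_linE !scale1r innerDl ab ba -innerDr addrC sp.
- by move=> v; rewrite /= !ppv.
have [|||t tP] := scal (p \o (((- 'i%C) *: a + ('i%C *: b + 0)) \o p)).
- by apply: corner; apply: star_lin => //; apply: star_lin => //; exact: star0.
- move=> u v; rewrite /= sp !op_linE !addr0 innerDl !innerZl ab ba.
  rewrite -[RHS]sp innerDr !innerZr addrC.
  have iE : (- 'i%C)^*%C = 'i%C :> R[i] by apply/eqP; rewrite eq_complex /= oppr0 opprK !eqxx.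
  have iE' : ('i%C)^*%C = - 'i%C :> R[i] by apply/eqP; rewrite eq_complex /= oppr0 !eqxx.
  by rewrite iE iE'.
- by move=> v; rewrite /= !ppv.
exists (2^-1 * (s%:C + 'i%C * t%:C)) => v.
have h1 := sP v; have h2 := tP v.
rewrite /= !op_linE scale1r (linD lp) in h1.
rewrite /= !op_linE addr0 (linD lp) !(linZ lp) in h2.
have ii : 'i%C * 'i%C = -1 :> R[i] by rewrite -expr2 sqr_i.
have h3 : ('i%C * t%:C) *: p v = p (a (p v)) - p (b (p v)).
  by rewrite -scalerA -h2 scalerDr !scalerA mulrN ii opprK scale1r scaleN1r.
rewrite -scalerA scalerDl -h1 h3 addrACA subrr addr0.
by rewrite -mulr2n -[X in _ *: X]scaler_nat scalerA mulVf ?scale1r// pnatr_eq0.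
Qed.

Lemma scalar_corner_abelian A p : star_subalgebra A -> projection_in A p ->
    (forall a, A a -> exists z : R[i], forall v, p (a (p v)) = z *: p v) ->
  abelian_projection A p.
Proof.
move=> sA pA scal; split=> // a b Aa Ab.
have lp := star_linear sA (projection_mem pA).
have [s sP] := scal _ Aa; have [t tP] := scal _ Ab.
apply/funext => v; rewrite /= !sP !tP !(linZ lp) !(projectionK _ pA) !scalerA.
by rewrite mulrC.
Qed.

(** Let x be self-adjoint in the corner p M p. The positive spectral projection g of x - t p
    commutes with p, so if p cannot be split, p g is 0 or p. Each t is then an upper or a lower
    bound of x on the range of p, which makes x a scalar there; and a corner consisting of scalars
    is abelian. *)
Lemma vn_split M p : von_neumann_algebra M -> projection_in M p -> p <> 0 ->
    ~ abelian_projection M p ->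
  exists p1 p2, [/\ projection_in M p1, projection_in M p2, p1 <> 0, p2 <> 0 &
    [/\ forall v, p v = p1 v + p2 v, forall v, p1 (p2 v) = 0, forall v, p (p1 v) = p1 v
      & forall v, p (p2 v) = p2 v]].
Proof.
move=> vM pM p0 nab; have sM := vn_star vM; have [Mp pp sp] := pM.
have lp := star_linear sM Mp; have ppv v := projectionK v pM.
apply: contrapT => nosplit; apply: nab; apply: scalar_corner_abelian => //.
apply: corner_scalar => // x Mx sx px; have lx := star_linear sM Mx.
have px1 v : p (x v) = x v by rewrite -px ppv.
have xp v : x (p v) = x v by rewrite -px ppv px.
have tri (t : R) : (forall v, p v = v -> t * rnorm v ^+ 2 <= rinner (x v) v) \/
    (forall v, p v = v -> rinner (x v) v <= t * rnorm v ^+ 2).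
  have Ma : M ((- t)%:C *: p + x) by exact: star_lin.
  have aE v : p v = v -> rinner (((- t)%:C *: p + x) v) v = rinner (x v) v - t * rnorm v ^+ 2.
    by move=> pv; rewrite op_linE pv rinnerDl rinnerZl rinnervv mulNr addrC.
  have [|g [gM gc pos neg]] := vn_hahn vM Ma; first exact: adjoint_real.
  have [Mg gg sg] := gM; have lg := star_linear sM Mg.
  have gp v : g (p v) = p (g v).
    have /(congr1 (fun f => f v)) : g \o p = p \o g; last by [].
    apply: gc => //; first exact: star_bounded sM Mp.
    by apply/funext => u; rewrite /= !op_linE ppv (linD lp) (linZ lp) ppv px1 xp.
  have pg1M : projection_in M (p \o g).
    split; first exact: star_comp.
      by apply/funext => v; rewrite /= gp (projectionK _ gM) ppv.
    by move=> u v; rewrite /= sp sg gp.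
  have pg2M : projection_in M (fun v => p v - p (g v)).
    split; first exact: starB sM Mp (projection_mem pg1M).
      apply/funext => v /=.
      by rewrite (linB lg) !(linB lp) !gp !ppv (projectionK _ gM) subrr subr0.
    by move=> u v; rewrite innerDl innerNl innerDr innerNr !sp sg gp.
  have [g1|g1] := pselect (p \o g = 0).
    right=> v pv; rewrite -subr_le0 -aE//; apply: neg.
    by rewrite -pv gp -[LHS]/((p \o g) v) g1.
  have [g2|g2] := pselect ((fun v => p v - p (g v)) = 0).
    left=> v pv; rewrite -subr_ge0 -aE//; apply: pos.
    have /(congr1 (fun f => f v)) /eqP := g2; rewrite subr_eq0 => /eqP.
    by rewrite -gp pv => <-.
  exfalso; apply: nosplit; exists (p \o g), (fun v => p v - p (g v)); split=> //; split.
  - by move=> v; rewrite addrC subrK.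
  - by move=> v /=; rewrite (linB lg) (linB lp) !gp !ppv (projectionK _ gM) subrr.
  - by move=> v /=; rewrite ppv.
  - by move=> v; rewrite (linB lp) !ppv.
have [v0 pv0] := projection_neq0 p0.
(* The lower bounds of x on the range of p; above the supremum of T, [tri] leaves only upper
   bounds. *)
pose T := [set t : R | forall v, p v = v -> t * rnorm v ^+ 2 <= rinner (x v) v].
have /bounded_opP[_ [K K0 xK]] := star_bounded sM Mx.
have xle v : `|rinner (x v) v| <= K * rnorm v ^+ 2.
  apply: le_trans (rinner_CauchySchwarz _ _) _.
  by have := xK v; have := rnorm_ge0 v; nra.
have Tsup : has_sup T.
  split.
    exists (- K) => v _; have := xle v; rewrite ler_norml => /andP[h _].
    by rewrite mulNr.
  exists K => t Tt; have := Tt (p v0) (ppv v0); have := xle (p v0).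
  rewrite ler_norml => /andP[_ h1] h2; have := le_trans h2 h1.
  rewrite ler_pM2r// lt_def sqrf_eq0 exprn_ge0 ?rnorm_ge0// andbT.
  by apply/eqP => /rnorm_eq0.
pose l := sup T; exists l.
have Tl v : p v = v -> l * rnorm v ^+ 2 <= rinner (x v) v.
  move=> pv; apply: squeeze_le => e e0.
  have n0 : 0 < 1 + rnorm v ^+ 2 by rewrite ltr_wpDr ?sqr_ge0.
  have r0 : 0 < e / (1 + rnorm v ^+ 2) by rewrite divr_gt0.
  have [t Tt] := sup_adherent r0 Tsup; rewrite -/l => lt; have := Tt _ pv.
  move: lt; rewrite ltrBlDr -ltrBlDl ltr_pdivlMr//.
  by have := sqr_ge0 (rnorm v); nra.
have Tu v : p v = v -> rinner (x v) v <= l * rnorm v ^+ 2.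
  move=> pv; apply: squeeze_le => e e0.
  have n0 : 0 < 1 + rnorm v ^+ 2 by rewrite ltr_wpDr ?sqr_ge0.
  have r0 : 0 < e / (1 + rnorm v ^+ 2) by rewrite divr_gt0.
  have [Tt|/(_ v pv)] := tri (l + e / (1 + rnorm v ^+ 2)).
    have : l + e / (1 + rnorm v ^+ 2) <= l by apply: ub_le_sup => //; case: Tsup.
    by rewrite gerDl leNgt r0.
  move=> h; apply: le_trans h _; rewrite mulrDl lerD2l -mulrA ger_pMr//.
  by rewrite ler_pdivrMl// mulr1 lerDr.
have z v : ((- l)%:C *: p + x) v = 0.
  apply: selfadjoint_eq0.
  - by apply: (star_linear sM); exact: star_lin.
  - exact: adjoint_real.
  move=> u; have -> : rinner (((- l)%:C *: p + x) u) u = rinner (x (p u)) (p u) - l * rnorm (p u) ^+ 2.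
    rewrite op_linE rinnerDl rinnerZl addrC mulNr -(px u) (rinner_adj _ u sp).
    by rewrite -[in rinner (p u) u]ppv (rinner_adj (p u) u sp) rinnervv.
  by apply/eqP; rewrite subr_eq0 eq_le Tl ?ppv// Tu ?ppv.
move=> v; have := z v; rewrite op_linE rmorphN scaleNr addrC => /eqP.
by rewrite subr_eq0 => /eqP.
Qed.

(** Take c below q with |c Psi|^2 < inf + d. A splitting c = p1 + p2 into orthogonal parts would
    give |c Psi|^2 = |p1 Psi|^2 + |p2 Psi|^2 >= inf + d. *)
Lemma exists_abelian_projection M Psi q (d : R) : von_neumann_algebra M ->
    projection_in M q -> q <> 0 -> 0 < d ->
    (forall c, projection_in M c -> c <> 0 -> (forall v, q (c v) = c v) ->
       d <= rnorm (c Psi) ^+ 2) ->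
  exists e, abelian_projection M e /\ e <> 0.
Proof.
move=> vM qM q0 d0 qd.
pose P c := [/\ projection_in M c, c <> 0 & forall v, q (c v) = c v].
pose E := (fun c => rnorm (c Psi) ^+ 2) @` [set c | P c].
have Einf : has_inf E.
  split; first by exists (rnorm (q Psi) ^+ 2), q => //; split=> // v; exact: projectionK qM.
  by exists 0 => _ [c _ <-]; exact: sqr_ge0.
have [_ [c [cM c0 qc] <-] cm] := inf_adherent d0 Einf.
have Ele c' : P c' -> inf E <= rnorm (c' Psi) ^+ 2.
  by move=> Pc; apply: ge_inf; [case: Einf|exists c'].
apply: contrapT => noab; have [|p1 [p2 [p1M p2M p10 p20 [pE p12 pp1 pp2]]]] := vn_split vM cM c0.
  by move=> abc; apply: noab; exists c.
have q1 v : q (p1 v) = p1 v by rewrite -pp1 qc.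
have q2 v : q (p2 v) = p2 v by rewrite -pp2 qc.
have h1 : inf E <= rnorm (p1 Psi) ^+ 2 by exact: Ele.
have h2 := qd _ p2M p20 q2.
move: cm; rewrite pE -rinnervv !rinnerE (rinnerC (p2 Psi)) !rinnervv.
have [_ _ s1] := p1M; rewrite (rinner_adj _ _ s1) p12 rinner0r; lra.
Qed.

End MinimalProjections.

(** * Weak limits along ultrafilters and the passage from the M_n to M *)

Section WeakLimits.
Context {R : realType} {H : hilbertType R}.
Implicit Types (u v w Psi : H) (a b c e p q x y : H -> H) (A M : set (H -> H)).

(** Compactness of [- K, K] gives a cluster point, and an ultrafilter converges to its cluster
    points. *)
Lemma ultra_cvg_segment (I : Type) (G : set_system I) (f : I -> R) (K : R) :
  UltraFilter G -> (forall n, `|f n| <= K) -> exists l : R, f @ G --> l.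
Proof.
move=> UG fK; have PG : ProperFilter (f @ G) by exact: fmap_proper_filter.
have [|l [_ lcl]] := segment_compact (a := - K) (b := K) PG.
  suff : G (f @^-1` `[- K, K]) by [].
  by apply: filterE => n; rewrite /= in_itv /= -ler_norml.
exists l => U Ul; have [//|GU] := in_ultra_setVsetC (f @^-1` U) UG.
by have [x [nUx /nUx]] := lcl (~` U) U GU Ul.
Qed.

Lemma eq_rinner u v : (forall w, rinner u w = rinner v w) -> u = v.
Proof.
move=> h; apply/eqP; rewrite -subr_eq0; apply/eqP; apply: rnorm_eq0.
by apply/eqP; rewrite -sqrf_eq0 -rinnervv rinnerDl rinnerNl h subrr.
Qed.

Lemma rinnerZC (c : R[i]) u v : rinner (c *: u) v = rinner u (c^*%C *: v).
Proof. by rewrite /rinner innerZl innerZr conjcK. Qed.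

Lemma weak_ultralimit (G : set_system nat) (a : nat -> H -> H) : UltraFilter G ->
    (forall n, linear (a n)) -> (forall n v, rnorm (a n v) <= rnorm v) ->
  exists e, bounded_op e /\ forall v w, rinner (a n v) w @[n --> G] --> rinner (e v) w.
Proof.
move=> UG la a1.
have PG : ProperFilter G by exact: ultra_proper.
have an_le n v w : `|rinner w (a n v)| <= rnorm v * rnorm w.
  apply: le_trans (rinner_CauchySchwarz _ _) _; rewrite mulrC.
  by apply: ler_wpM2r; [exact: rnorm_ge0|exact: a1].
have [L LP] : exists L : H -> H -> R, forall v w, rinner w (a n v) @[n --> G] --> L v w.
  have /choice[L LP] : forall vw : H * H, exists l : R, rinner vw.2 (a n vw.1) @[n --> G] --> l.
    by move=> [v w]; apply: (ultra_cvg_segment UG (fun n => an_le n v w)).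
  by exists (fun v w => L (v, w)) => v w; exact: LP (v, w).
have Luniq v w (l : R) : rinner w (a n v) @[n --> G] --> l -> L v w = l.
  by move=> h; apply: (cvg_unique _ (LP v w) h); exact: Rhausdorff.
have LD v w w' : L v (w + w') = L v w + L v w'.
  apply: Luniq; rewrite (_ : (fun _ => _) = (fun n => rinner w (a n v) + rinner w' (a n v))).
    exact: cvgD (LP v w) (LP v w').
  by apply/funext => n; rewrite rinnerDl.
have LZ v (t : R) w : L v (t%:C *: w) = t * L v w.
  apply: Luniq; rewrite (_ : (fun _ => _) = (fun n => t * rinner w (a n v))).
    exact: cvgMr (LP v w).
  by apply/funext => n; rewrite rinnerZl.
have Lle v w : `|L v w| <= rnorm v * rnorm w.
  rewrite ler_norml; apply/andP; split.
    apply: (cvgr_to_ge (LP v w)); apply: filterE => n /=.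
    by have := an_le n v w; rewrite ler_norml => /andP[].
  apply: (cvgr_to_le (LP v w)); apply: filterE => n /=.
  by have := an_le n v w; rewrite ler_norml => /andP[].
(* L v w is the limit of the real part of [inner w (a n v)] and L v (i w) that of minus its
   imaginary part, so F v w is the limit of the inner product itself, linear in w. *)
pose F v w : R[i] := L v w -i* L v ('i%C *: w).
have Lc v (s t : R) w : L v ((s +i* t) *: w) = s * L v w + t * L v ('i%C *: w).
  have -> : s +i* t = s%:C + t%:C * 'i%C :> R[i].
    by apply/eqP; rewrite eq_complex /=; apply/andP; split; apply/eqP; ring.
  by rewrite scalerDl LD (LZ v s w) -scalerA (LZ v t ('i%C *: w)).
have Flin v (c : R[i]) (w w' : H) : F v (c *: w + w') = c * F v w + F v w'.
  case: c => s t; apply/eqP; rewrite eq_complex.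
  have E : 'i%C * (s +i* t) = (- t) +i* s :> R[i].
    by apply/eqP; rewrite eq_complex /=; apply/andP; split; apply/eqP; ring.
  rewrite /F scalerDr scalerA E !LD (Lc v s t w) (Lc v (- t) s w) /=.
  by apply/andP; split; apply/eqP; ring.
(* The factor 2 comes from bounding the real and imaginary parts of F separately. *)
have /choice[e eP] : forall v, exists z : H, rnorm z <= 2 * rnorm v /\
    forall w, setT w -> F v w = inner w z.
  move=> v; apply: (@riesz_le R H H setT idfun (F v)) => //.
  - by rewrite mulr_ge0// rnorm_ge0.
  - move=> w _; rewrite -[F v w]addr0 -[0](subrr (L v w)%:C).
    have -> : F v w + ((L v w)%:C - (L v w)%:C) =
        (L v w)%:C + - (L v ('i%C *: w))%:C * 'i%C.
      by apply/eqP; rewrite eq_complex /=; apply/andP; split; apply/eqP; ring.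
    apply: le_trans (ler_rnormD _ _) _; rewrite mulNr rnormN rnormM.
    have rr (t : R) : rnorm t%:C = `|t|.
      by apply: (@complexI R); rewrite -rnormE normc_def /= expr0n addr0 sqrtr_sqr.
    have ri : rnorm ('i%C : R[i]) = 1.
      by apply: (@complexI R); rewrite -rnormE normc_def /= expr0n expr1n add0r sqrtr1.
    rewrite !rr ri mulr1 -mulrA mulr_natl mulr2n; apply: lerD; first exact: Lle.
    by apply: le_trans (Lle _ _) _; rewrite rnormZ ri mul1r.
have eL v w : rinner (a n v) w @[n --> G] --> rinner (e v) w.
  have -> : rinner (e v) w = L v w by rewrite rinnerC /rinner -(eP v).2.
  have := LP v w; rewrite (_ : (fun _ => _) = (fun n => rinner (a n v) w))//.
  by apply/funext => n; rewrite rinnerC.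
exists e; split=> //; apply/bounded_opP; split; last first.
  by exists 2 => // v; exact: (eP v).1.
move=> c u v; apply: eq_rinner => w; rewrite rinnerDl rinnerZC.
apply: (cvg_unique _ (eL _ _)); first exact: Rhausdorff.
rewrite (_ : (fun _ => _) = (fun n => rinner (a n u) (c^*%C *: w) + rinner (a n v) w)).
  exact: cvgD (eL _ _) (eL _ _).
by apply/funext => n; rewrite la rinnerDl rinnerZC.
Qed.

(** The limit e is taken along an ultrafilter refining [\oo]. It commutes with M' because every a_n
    does, hence lies in M. *)
Lemma wot_limit_compression (Mn : nat -> set (H -> H)) M Psi (a : nat -> H -> H) (K t : R) :
    von_neumann_algebra M -> 0 <= K ->
    (forall m n, (m <= n)%N -> Mn m `<=` Mn n) ->
    (forall n, star_subalgebra (Mn n) /\ Mn n `<=` M) ->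
    M = wot_closure (\bigcup_n Mn n) ->
    (forall n, [/\ Mn n (a n), is_adjoint (a n) (a n) & forall v, rnorm (a n v) <= rnorm v]) ->
    (forall n x v, Mn n x -> rnorm (x (a n v)) <= K * rnorm (x Psi) * rnorm v) ->
    (forall n, t <= rinner (a n Psi) Psi) ->
  exists e, [/\ M e, is_adjoint e e, t <= rinner (e Psi) Psi
    & forall x v, M x -> rnorm (x (e v)) <= K * rnorm (x Psi) * rnorm v].
Proof.
move=> vM K0 mono sMn Mcl aP aK at0.
have [G [UG GF]] := @ultraFilterLemma nat \oo _.
have PG : ProperFilter G by exact: ultra_proper.
have la n : linear (a n) by have [Ma _ _] := aP n; exact: star_linear (sMn n).1 Ma.
have [e [be eL]] := weak_ultralimit UG la (fun n => let: And3 _ _ h := aP n in h).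
have le := bounded_linear be.
have uniq v w (l : R) : rinner (a n v) w @[n --> G] --> l -> rinner (e v) w = l.
  by move=> h; apply: (cvg_unique _ (eL v w) h); exact: Rhausdorff.
have se : is_adjoint e e.
  move=> u v; apply: inner_eq_Re => c; rewrite rinnerZC.
  apply: uniq; rewrite rinnerC; move: (eL v (c *: u)).
  rewrite (_ : (fun _ => _) = (fun n => rinner (a n u) (c^*%C *: v)))//.
  apply/funext => n; have [_ sa _] := aP n.
  by rewrite rinnerC -rinnerZC -(linZ (la n)) (rinner_adj _ _ sa).
have Me : M e.
  apply: vn_mem => // b [bb bM]; have [x bx adj] := adjoint_exists bb.
  apply/funext => v; apply: eq_rinner => w /=.
  rewrite (rinner_adj _ _ adj); apply/esym; apply: uniq.
  move: (eL v (x w)); rewrite (_ : (fun _ => _) = (fun n => rinner (a n (b v)) w))//.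
  apply/funext => n; rewrite -(rinner_adj _ _ adj); congr (rinner _ w).
  have [Ma _ _] := aP n; have := bM _ ((sMn n).2 _ Ma).
  by move=> /(congr1 (fun f => f v)).
(* For x in M_m the bound holds for all n >= m, a set that belongs to G. It passes to the limit in
   <a_n v, x^* w>, where w = x (e v). *)
have eK m x v : Mn m x -> rnorm (x (e v)) <= K * rnorm (x Psi) * rnorm v.
  move=> Mx; have bx := star_bounded (sMn m).1 Mx.
  have [y _ adj] := adjoint_exists bx; set w := x (e v).
  have [->|n0] := eqVneq (rnorm w) 0; first by rewrite !mulr_ge0 ?rnorm_ge0.
  have n1 : 0 < rnorm w by rewrite lt_def n0 rnorm_ge0.
  rewrite -(ler_pM2r n1) -expr2 -rinnervv {1}/w (rinner_adj _ _ adj).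
  apply: (cvgr_to_le (eL v (y w))); apply: GF; exists m => // n /= mn.
  rewrite -(rinner_adj _ _ adj); apply: le_trans (ler_norm _) _.
  apply: le_trans (rinner_CauchySchwarz _ _) _.
  by apply: ler_wpM2r; [exact: rnorm_ge0|apply: aK; exact: mono Mx].
exists e; split=> //.
  by apply: (cvgr_to_ge (eL Psi Psi)); exact: filterE.
move=> x v Mx; set w := x (e v).
have [->|n0] := eqVneq (rnorm w) 0; first by rewrite !mulr_ge0 ?rnorm_ge0.
have n1 : 0 < rnorm w by rewrite lt_def n0 rnorm_ge0.
(* The vector w = x (e v) is frozen while y ranges over the union of the M_n; the resulting z has
   |z| <= K |v| |w|, and weak closure then allows y = x. *)
have [||c y z [m _ My] [n _ Mz]|||y [m _ My]|z [zK zP]] := @riesz_le R H _ (\bigcup_n Mn n) (fun y => y Psi)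
  (fun y => inner (y (e v)) w) (K * rnorm v * rnorm w).
- by rewrite !mulr_ge0 ?rnorm_ge0.
- by exists 0%N => //; exact: star0 (sMn 0%N).1.
- exists (maxn m n) => //; apply: star_lin (sMn _).1 _ _.
    by apply: mono My; exact: leq_maxl.
  by apply: mono Mz; exact: leq_maxr.
- by [].
- by move=> c y z _ _; rewrite op_linE innerDl innerZl.
- apply: le_trans (inner_CauchySchwarz _ _) _.
  rewrite [leRHS](_ : _ = K * rnorm (y Psi) * rnorm v * rnorm w); last by ring.
  by apply: ler_wpM2r; [exact: rnorm_ge0|exact: eK My].
have xz : inner w w = inner (x Psi) z.
  rewrite {1}/w; move: Mx; rewrite Mcl => Mx.
  apply: (wot_closure_inner Mx) => y Ny; exact: zP.
rewrite -(ler_pM2r n1) -expr2 -rinnervv /rinner xz.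
apply: le_trans (ler_norm _) _; apply: le_trans (rinner_CauchySchwarz _ _) _.
rewrite [leRHS](_ : _ = rnorm (x Psi) * (K * rnorm v * rnorm w)); last by ring.
by apply: ler_wpM2l; [exact: rnorm_ge0|].
Qed.

(** With s = t / 2 and p the positive spectral projection of e - s, a nonzero projection c below p
    and v in its range satisfy s |v|^2 <= <e v, v> = <c (e v), v> <= K |c Psi| |v|^2, so |c Psi| >=
    s / K. *)
Lemma abelian_of_compression M Psi e (K t : R) : von_neumann_algebra M -> rnorm Psi = 1 ->
    0 < t -> 0 < K -> M e -> is_adjoint e e -> t <= rinner (e Psi) Psi ->
    (forall x v, M x -> rnorm (x (e v)) <= K * rnorm (x Psi) * rnorm v) ->
  exists p, abelian_projection M p /\ p <> 0.
Proof.
move=> vM Psi1 t0 K0 Me se et eK; have sM := vn_star vM.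
pose s := t / 2; have s0 : 0 < s by rewrite divr_gt0.
have [||p [pM _ pos neg]] := @vn_hahn _ _ M ((- s)%:C *: idfun + e) vM.
- by apply: star_lin => //; exact: vn_id.
- exact: adjoint_real.
have aE v : rinner (((- s)%:C *: idfun + e) v) v = rinner (e v) v - s * rnorm v ^+ 2.
  by rewrite op_linE rinnerDl rinnerZl rinnervv mulNr addrC.
apply: (@exists_abelian_projection _ _ M Psi p ((s / K) ^+ 2)) => //.
- move=> p0; have := neg Psi; rewrite p0 aE Psi1 expr1n mulr1 => /(_ erefl).
  by rewrite /s; lra.
- by rewrite exprn_gt0// divr_gt0.
move=> c cM c0 pc; have [v0 cv0] := projection_neq0 c0.
set v := c v0; have pv : p v = v by exact: pc.
have v1 : 0 < rnorm v by rewrite lt_def rnorm_ge0 andbT; apply/eqP => /rnorm_eq0.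
have [Mc _ sc] := cM.
have h1 : s * rnorm v ^+ 2 <= rinner (e v) v by rewrite -subr_ge0 -aE pos.
have h2 : rinner (e v) v <= K * rnorm (c Psi) * rnorm v ^+ 2.
  rewrite -[X in rinner _ X](projectionK v0 cM) -/v -(rinner_adj _ _ sc).
  apply: le_trans (ler_norm _) _; apply: le_trans (rinner_CauchySchwarz _ _) _.
  rewrite expr2 mulrA; apply: ler_wpM2r; first exact: rnorm_ge0.
  exact: eK.
rewrite ler_pXn2r ?nnegrE ?rnorm_ge0 ?(divr_ge0 (ltW s0) (ltW K0))//.
rewrite ler_pdivrMr// mulrC.
by have := le_trans h1 h2; rewrite ler_pM2r// exprn_gt0.
Qed.

End WeakLimits.

(** * Eigenvalues and minimal projections in finite-dimensional star-algebras *)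

Section FiniteDimensional.
Context {R : realType} {H : hilbertType R}.
Implicit Types (u v w : H) (a b e f p q x y : H -> H) (A : set (H -> H)).

Lemma lin_sum (I : Type) (s : seq I) (F : I -> H) a : linear a ->
  a (\sum_(i <- s) F i) = \sum_(i <- s) a (F i).
Proof.
by move=> la; apply: (big_morph a) => [u v|]; [exact: linD|exact: lin0].
Qed.

Lemma inner_suml (I : Type) (s : seq I) (F : I -> H) v :
  inner (\sum_(i <- s) F i) v = \sum_(i <- s) inner (F i) v.
Proof.
by apply: (big_morph (fun u => inner u v)) => [u w|]; [exact: innerDl|exact: inner0l].
Qed.

Lemma inner_sumr (I : Type) (s : seq I) (F : I -> H) v :
  inner v (\sum_(i <- s) F i) = \sum_(i <- s) inner v (F i).
Proof.
by apply: (big_morph (inner v)) => [u w|]; [exact: innerDr|exact: inner0r].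
Qed.

Lemma star_sum A n (F : 'I_n -> H -> H) : star_subalgebra A -> (forall i, A (F i)) ->
  A (fun v => \sum_(i < n) F i v).
Proof.
move=> sA; elim: n F => [|n IH] F AF.
  rewrite (_ : (fun _ => _) = 0); first exact: star0.
  by apply/funext => v; rewrite big_ord0.
rewrite (_ : (fun _ => _) = fun v => F ord0 v + \sum_(i < n) F (lift ord0 i) v).
  by apply: (starD sA) => //; exact: IH.
by apply/funext => v; rewrite big_ord_recl.
Qed.

Lemma finite_dimensionalP A : finite_dimensional A -> exists k (b : 'I_k -> H -> H),
  (forall i, A (b i)) /\
  forall a, A a -> exists c : 'I_k -> R[i], forall v, a v = \sum_(i < k) c i *: b i v.
Proof.
move=> [k [b ->]]; exists k, b.
have E (c : 'I_k -> R[i]) v : (\sum_(i < k) c i *: b i) v = \sum_(i < k) c i *: b i v.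
  by apply: (big_morph (fun a : H -> H => a v)).
split=> [i|_ [c _ <-]]; last by exists c.
exists (fun j => (j == i)%:R) => //; apply/funext => v; rewrite E (bigD1 i)//= eqxx scale1r.
by rewrite big1 ?addr0// => j /negPf ->; rewrite scale0r.
Qed.

(** The coefficient matrix of more than k elements over k spanning ones has a nonzero left
    kernel. *)
Lemma finite_dimensional_dependent A : finite_dimensional A ->
  exists k, forall n (F : 'I_n -> H -> H), (k < n)%N -> (forall i, A (F i)) ->
  exists2 c : 'rV[R[i]]_n, c != 0 & forall v, \sum_(i < n) c 0 i *: F i v = 0.
Proof.
move=> /finite_dimensionalP[k [b [_ bA]]]; exists k => n F kn AF.
have /choice[G GP] : forall i, exists c : 'I_k -> R[i], forall v, F i v = \sum_(j < k) c j *: b j v.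
  by move=> i; exact: bA.
pose B : 'M[R[i]]_(n, k) := \matrix_(i, j) G i j.
have : kermx B != 0.
  rewrite kermx_eq0 /row_free neq_ltn; apply/orP; left.
  exact: leq_ltn_trans (rank_leq_col B) kn.
move=> /rowV0Pn[c /sub_kermxP cB c0]; exists c => // v.
under eq_bigr => i _ do rewrite GP scaler_sumr.
rewrite exchange_big big1 // => j _.
have : (c *m B) 0 j = 0 by rewrite cB mxE.
rewrite mxE => h; under eq_bigr => i _ do rewrite scalerA.
rewrite -scaler_suml; have -> : \sum_(i < n) c 0 i * G i j = 0.
  by rewrite -[RHS]h; apply: eq_bigr => i _; rewrite mxE.
exact: scale0r.
Qed.

Section Eigen.
Variables (x : H -> H).
Hypotheses (lx : linear x) (sx : is_adjoint x x).
Implicit Types (r s z : R[i]) (rs : seq R[i]).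

Definition shift_op r u : H := x u - r *: u.
Definition shift_prod rs u : H := foldr shift_op u rs.

Lemma shift_op_lin r : linear (shift_op r).
Proof.
move=> c u v; rewrite /shift_op lx scalerDr opprD scalerBr !scalerA mulrC.
by rewrite addrACA.
Qed.

Lemma shift_prod_lin rs : linear (shift_prod rs).
Proof. by elim: rs => // r rs IH c u v; rewrite /= IH (shift_op_lin r c). Qed.

Lemma shift_op_comm r a u : linear a -> (forall u, a (x u) = x (a u)) ->
  shift_op r (a u) = a (shift_op r u).
Proof. by move=> la ax; rewrite /shift_op (linB la) (linZ la) ax. Qed.

Lemma shift_prod_comm rs a u : linear a -> (forall u, a (x u) = x (a u)) ->
  shift_prod rs (a u) = a (shift_prod rs u).
Proof. by move=> la ax; elim: rs => // r rs IH; rewrite /= IH shift_op_comm. Qed.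

Lemma x_shift_op r u : shift_op r (x u) = x (shift_op r u).
Proof. exact: shift_op_comm. Qed.

Lemma shift_op_adj r u v : inner (shift_op r u) v = inner u (shift_op r^*%C v).
Proof. by rewrite /shift_op innerDl innerNl innerZl innerDr innerNr innerZr conjcK sx. Qed.

Lemma shift_prod_adj rs u v :
  inner (shift_prod rs u) v = inner u (shift_prod (map (@conjc R) rs) v).
Proof.
elim: rs v => //= r rs IH v; rewrite shift_op_adj IH; congr (inner u _).
apply: shift_prod_comm; first exact: shift_op_lin.
by move=> w; exact: x_shift_op.
Qed.

Lemma shift_prod_eigen rs (l : R[i]) u : x u = l *: u ->
  shift_prod rs u = (\prod_(r <- rs) (l - r)) *: u.
Proof.
move=> xu; elim: rs => [|r rs IH]; first by rewrite big_nil scale1r.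
rewrite /= IH big_cons /shift_op (linZ lx) xu !scalerA -scalerBl.
by congr (_ *: _); ring.
Qed.

Lemma star_shift_prod A rs p : star_subalgebra A -> A x -> A p ->
  A (fun v => shift_prod rs (p v)).
Proof.
move=> sA Ax Ap; elim: rs => // r rs IH.
exact: (starB sA (star_comp sA Ax IH) (starZ r sA IH)).
Qed.

(** Factors are dropped one at a time until the product no longer vanishes on the range of p; its
    values there lie in the eigenspace of the root dropped last. *)
Lemma shift_prod_eigenvalue rs p : p <> 0 -> (forall v, shift_prod rs (p v) = 0) ->
  exists rs' r, (exists v, shift_prod rs' (p v) <> 0) /\
    forall v, shift_op r (shift_prod rs' (p v)) = 0.
Proof.
move=> p0; elim: rs => [pv|r rs IH h].
  by case: p0; apply/funext => v; exact: pv.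
have [/IH//|nz] := pselect (forall v, shift_prod rs (p v) = 0).
exists rs, r; split=> //; apply: contrapT => h'; apply: nz => v.
by apply: contrapT => nv; apply: h'; exists v.
Qed.

(* Cayley-Hamilton for the left multiplication by x on A; the matrix X need not be
   unique, as the spanning family b of A may be dependent. *)
Lemma shift_prod_annihilates A : star_subalgebra A -> finite_dimensional A -> A x ->
  exists rs, forall a v, A a -> shift_prod rs (a v) = 0.
Proof.
move=> sA /finite_dimensionalP[[|k] [b [Ab bA]]] Ax.
  by exists [::] => a v /bA[c ->]; rewrite big_ord0.
have /choice[m mP] : forall i, exists c : 'I_k.+1 -> R[i],
    forall v, x (b i v) = \sum_(j < k.+1) c j *: b j v.
  by move=> i; apply: (bA (x \o b i)); exact: star_comp.
pose X : 'M[R[i]]_k.+1 := \matrix_(i, j) m i j.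
have key rs i v : shift_prod rs (b i v) =
    \sum_(j < k.+1) (horner_mx X (\prod_(r <- rs) ('X - r%:P))) i j *: b j v.
  elim: rs => [|r rs IH] /=.
    rewrite big_nil rmorph1 (bigD1 i)//= mxE eqxx scale1r big1 ?addr0// => j.
    by rewrite mxE eq_sym => /negPf ->; rewrite scale0r.
  rewrite IH big_cons mulrC rmorphM rmorphB /= horner_mx_X horner_mx_C.
  rewrite (lin_sum _ _ (shift_op_lin r)).
  under [RHS]eq_bigr => j _ do rewrite mxE scaler_suml.
  rewrite exchange_big /=; apply: eq_bigr => j _.
  rewrite (linZ (shift_op_lin r)) /shift_op mP scalerBr scaler_sumr scalerA.
  under [RHS]eq_bigr => l _ do rewrite !mxE mulrBr scalerBl -scalerA.
  rewrite sumrB; congr (_ - _).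
  rewrite (bigD1 j)//= eqxx mulr1n [X in _ = _ + X]big1 ?addr0// => l.
  by rewrite eq_sym => /negPf ->; rewrite mulr0n mulr0 scale0r.
have [rs rsE] := closed_field_poly_normal (char_poly X).
exists rs => a v /bA[c ->]; rewrite (lin_sum _ _ (shift_prod_lin rs)) big1 // => i _.
rewrite (linZ (shift_prod_lin rs)) key.
have /monicP lc := char_poly_monic X; move: rsE; rewrite lc scale1r => <-.
rewrite Cayley_Hamilton big1 ?scaler0// => j _.
by rewrite mxE scale0r.
Qed.

(** The values of y, a product of factors x - r applied after p, lie in the l-eigenspace of x, on
    which y and its adjoint y' act through the scalars mu and nu. So g = y' y satisfies g^2 = nu mu
    g, and a multiple of g is a nonzero projection f below p with x f = l f. If f = p, then x = l
    p. *)
Lemma finite_dimensional_split A p : star_subalgebra A -> finite_dimensional A ->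
    projection_in A p -> p <> 0 -> A x -> (forall v, p (x (p v)) = x v) ->
  (exists t : R, forall v, x v = t%:C *: p v) \/
  (exists f, [/\ projection_in A f, f <> 0, forall v, p (f v) = f v & f <> p]).
Proof.
move=> sA fA pA p0 Ax px; have [Ap _ sp] := pA; have lp := star_linear sA Ap.
have ppv v := projectionK v pA.
have px1 v : p (x v) = x v by rewrite -px ppv.
have xp v : x (p v) = x v by rewrite -px ppv px.
have pxc u : p (x u) = x (p u) by rewrite px1 xp.
have [rs rsP] := shift_prod_annihilates sA fA Ax.
have [qs [l [[v0 y0] xy]]] := shift_prod_eigenvalue p0 (fun v => rsP _ v Ap).
pose y v := shift_prod qs (p v); pose y' v := shift_prod (map (@conjc R) qs) (p v).
have {}xy v : x (y v) = l *: y v.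
  by apply/eqP; rewrite -subr_eq0; apply/eqP; exact: xy.
have py v : p (y v) = y v by rewrite /y -shift_prod_comm// ppv.
have adj : is_adjoint y y'.
  by move=> u v; rewrite /y /y' shift_prod_adj sp -shift_prod_comm.
pose mu : R[i] := \prod_(r <- qs) (l - r).
pose nu : R[i] := \prod_(r <- map (@conjc R) qs) (l - r).
have yyE v : y (y v) = mu *: y v by rewrite {1}/y py; exact: shift_prod_eigen.
have gE v : y' (y v) = nu *: y v by rewrite /y' py; exact: shift_prod_eigen.
have ly : linear y by move=> c u v; rewrite /y lp shift_prod_lin.
have ly' : linear y' by move=> c u v; rewrite /y' lp shift_prod_lin.
pose g v := y' (y v).
have ggE v : g (g v) = (nu * mu) *: g v.
  rewrite [g v](gE v) /g (linZ ly) (linZ ly') yyE (linZ ly') gE !scalerA.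
  by congr (_ *: _); ring.
have gv v : inner (g v) v = inner (y v) (y v) by rewrite (adjoint_sym adj).
have sg : is_adjoint g g by move=> u v; rewrite /g (adjoint_sym adj) adj.
have yv0 : rnorm (y v0) != 0 by apply/eqP => /rnorm_eq0.
pose t : R := rnorm (g v0) ^+ 2 / rnorm (y v0) ^+ 2.
(* Compare <g (g v0), v0> = |g v0|^2 with <g v0, v0> = |y v0|^2. *)
have tE : nu * mu = t%:C.
  have : inner (g (g v0)) v0 = inner (g v0) (g v0) by rewrite sg.
  rewrite ggE innerZl gv !innervv => h.
  rewrite /t rmorphM fmorphV /= -h mulfK//; apply: contra yv0.
  by rewrite -[0]/(0%:C) => /eqP/(@complexI R)/eqP; rewrite sqrf_eq0.
have t0 : t != 0.
  rewrite /t mulf_neq0 ?invr_neq0 ?sqrf_eq0//; apply/eqP => /rnorm_eq0 g0.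
  move: (gv v0); rewrite g0 inner0l innervv -[0]/(0%:C) => /(@complexI R)/esym/eqP.
  by rewrite sqrf_eq0; apply/negP.
pose f v := t^-1%:C *: g v.
have Af : A f.
  apply: (starZ _ sA (a := g)); apply: (star_comp sA (a := y') (b := y));
  exact: star_shift_prod.
have lg : linear g by move=> c u v; rewrite /g ly ly'.
have fM : projection_in A f.
  split=> //; last by move=> u v; rewrite /f innerZl innerZr conjc_real sg.
  apply/funext => v; rewrite /= /f (linZ lg) ggE tE !scalerA.
  by congr (_ *: _); rewrite -!rmorphM /= -mulrA mulVf ?mulr1.
have pf v : p (f v) = f v by rewrite /f (linZ lp) /g gE (linZ lp) py.
have f0 : f v0 <> 0.
  move=> /eqP; rewrite scaler_eq0 -[0]/(0%:C) => /orP[/eqP/(@complexI R)/eqP|/eqP g0].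
    by rewrite invr_eq0; apply/negP.
  by move/eqP: t0; apply; rewrite /t g0 rnorm0 expr0n mul0r.
have [fp|fp] := pselect (f = p); last first.
  by right; exists f; split=> // f00; apply: f0; rewrite f00.
left; have xf v : x (f v) = l *: f v.
  by rewrite /f (linZ lx) /g gE (linZ lx) xy !scalerA; congr (_ *: _); ring.
have xE v : x v = l *: p v by rewrite -xp -fp xf.
(* The root l is a priori complex; self-adjointness of x at the eigenvector f v0 makes it real. *)
exists (complex.Re l) => v; rewrite xE RRe_real//.
have h := selfadjoint_inner_real (f v0) sx.
move: h; rewrite xf innerZl innervv => h.
have n0 : (rnorm (f v0) ^+ 2)%:C != 0 :> R[i].
  by apply/eqP; rewrite -[0]/(0%:C) => /(@complexI R)/eqP; rewrite sqrf_eq0 => /eqP/rnorm_eq0.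
by rewrite -(mulfK n0 l) h realM ?realV ?complex_real.
Qed.

End Eigen.

(** Otherwise every nonzero projection of A has a proper nonzero subprojection. Iterating from the
    identity gives a strictly decreasing sequence, whose successive differences are nonzero and
    mutually orthogonal: too many independent elements. *)
Lemma minimal_projection A : star_subalgebra A -> finite_dimensional A -> A idfun ->
    (exists v : H, v <> 0) ->
  exists q, [/\ projection_in A q, q <> 0 &
    forall a, A a -> exists z : R[i], forall v, q (a (q v)) = z *: q v].
Proof.
move=> sA fA Aid [v00 v000]; apply: contrapT => nomin.
pose Q p := projection_in A p /\ p <> 0.
have /choice[F FP] : forall p, exists f, Q p -> [/\ Q f, forall v, p (f v) = f v & f <> p].
  move=> p; have [[pA p0]|nQ] := pselect (Q p); last by exists p.
  apply: contrapT => nf; apply: nomin; exists p; split=> //.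
  apply: (corner_scalar sA pA) => x Ax sx px.
  have [//|[f [fA' f0 pf fp]]] := finite_dimensional_split (star_linear sA Ax) sx sA fA pA p0 Ax px.
  by case: nf; exists f.
pose f n := iter n F idfun.
have Qf n : Q (f n).
  elim: n => [|n IH]; last by have [] := FP _ IH.
  by split; [split|move=> /(congr1 (fun a => a v00))].
have fS n v : f n (f n.+1 v) = f n.+1 v by have [_ h _] := FP _ (Qf n); exact: h.
have fneq n : f n.+1 <> f n by have [] := FP _ (Qf n).
have lf n := star_linear sA (projection_mem (Qf n).1).
have fle m n v : f m (f (m + n)%N v) = f (m + n)%N v.
  elim: n v => [|n IH] v; first by rewrite addn0 (projectionK _ (Qf m).1).
  by rewrite addnS -fS IH.
have fge m n v : f (m + n)%N (f m v) = f (m + n)%N v.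
  have [[_ _ s1] _] := Qf m; have [[_ _ s2] _] := Qf (m + n)%N.
  by apply: eq_inner_r => w; rewrite -s2 -s1 fle s2.
pose g n v := f n v - f n.+1 v.
have /choice[w wP] : forall n, exists v, g n v <> 0.
  move=> n; apply: contrapT => h; apply: (fneq n); apply/esym/funext => v.
  apply/eqP; rewrite -subr_eq0; apply/eqP; apply: contrapT => gv.
  by apply: h; exists v.
have fg_le m n v : f m (g (m + n)%N v) = g (m + n)%N v.
  by rewrite /g (linB (lf m)) fle -addnS fle.
have fg_gt m n v : f (m + n)%N.+1 (g m v) = 0.
  by rewrite /g (linB (lf _)) -addSn fge addSn -addnS fge subrr.
have fg m n v : f m (g n v) = if (m <= n)%N then g n v else 0.
  case: leqP => [/subnKC <-|/subnKC <-]; first exact: fg_le.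
  by rewrite addSn fg_gt.
have gg m n v : g m (g n v) = if m == n then g n v else 0.
  rewrite {1}/g !fg; case: ltngtP => _; first by rewrite subrr.
    by rewrite subrr.
  by rewrite subr0.
have [k kP] := finite_dimensional_dependent fA.
have [i|c c0 cg] := kP k.+1 (fun i => g i) (ltnSn k).
  by apply: starB => //; exact: projection_mem (Qf _).1.
move/negP: c0; apply; apply/eqP/rowP => i; rewrite mxE.
have := cg (g i (w i)); rewrite (bigD1 i)//= big1 => [|j ji]; last first.
  by rewrite gg (negPf (_ : (j : nat) != i)) ?scaler0.
rewrite addr0 gg eqxx => /eqP.
by rewrite scaler_eq0 => /orP[/eqP//|/eqP /wP].
Qed.

End FiniteDimensional.

(** * Matrix units in finite-dimensional simple star-algebras *)

Section MatrixUnits.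
Context {R : realType} {H : hilbertType R}.
Implicit Types (u v w : H) (q x y : H -> H) (A : set (H -> H)).

(* Orthonormal families of the left module A q, with inner product y* x = <x, y> q. *)
Definition frame A q n (a s : 'I_n -> H -> H) : Prop :=
  [/\ forall i, A (a i), forall i, is_adjoint (a i) (s i), forall i v, a i (q v) = a i v
    & forall i j v, s i (a j v) = (i == j)%:R *: q v].

(** Gram-Schmidt: r is the component of x q orthogonal to the family, r^* r = z q by minimality of
    q, and r / sqrt z is the new member. *)
Lemma frame_extend A q n (a s : 'I_n -> H -> H) x v0 :
    star_subalgebra A -> projection_in A q ->
    (forall y, A y -> exists z : R[i], forall v, q (y (q v)) = z *: q v) ->
    frame A q a s -> A x -> x (q v0) <> \sum_(i < n) a i (s i (x (q v0))) ->
  exists a' s' : 'I_n.+1 -> H -> H, frame A q a' s'.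
Proof.
move=> sA qA scal [Aa adj aq sa] Ax xv0; have [Aq qq sq] := qA.
have As i : A (s i) := star_adjoint sA (Aa i) (adj i).
have lq := star_linear sA Aq; have lx := star_linear sA Ax.
have la i := star_linear sA (Aa i); have ls i := star_linear sA (As i).
have qs i v : q (s i v) = s i v.
  by apply: eq_inner_r => w; rewrite -sq -adj aq adj.
pose r v := x (q v) - \sum_(i < n) a i (s i (x (q v))).
have Ar : A r.
  apply: (starB sA (star_comp sA Ax Aq)).
  apply: (star_sum (F := fun i => a i \o (s i \o (x \o q))) sA) => i.
  by apply: star_comp => //; apply: star_comp => //; exact: star_comp.
have lr := star_linear sA Ar.
have [r' _ adr] := adjoint_exists (star_bounded sA Ar).
have Ar' := star_adjoint sA Ar adr; have lr' := star_linear sA Ar'.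
have rq v : r (q v) = r v by rewrite /r (projectionK _ qA).
have qr' v : q (r' v) = r' v by apply: eq_inner_r => w; rewrite -sq -adr rq adr.
have sr j v : s j (r v) = 0.
  rewrite /r (linB (ls j)) (lin_sum _ _ (ls j)) (bigD1 j)//= big1 => [|i ij].
    by rewrite sa eqxx scale1r qs addr0 subrr.
  by rewrite sa eq_sym (negPf ij) scale0r.
have r'a j v : r' (a j v) = 0.
  by apply: eq_inner => w; rewrite (adjoint_sym adr) adj sr inner0r inner0l.
have [z zP] := scal _ (star_comp sA Ar' Ar).
have rr v : r' (r v) = z *: q v by rewrite -zP /= rq qr'.
have rv0 : rnorm (r v0) != 0.
  by apply/eqP => /rnorm_eq0/eqP; rewrite subr_eq0 => /eqP.
have qv0 : rnorm (q v0) != 0.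
  apply: contra rv0 => /eqP/rnorm_eq0 h; rewrite -rq h (lin0 lr) rnorm0.
  by [].
(* The value of z, read off at v0, where r does not vanish; it is positive, as the normalization
   requires. *)
pose t : R := rnorm (r v0) ^+ 2 / rnorm (q v0) ^+ 2.
have t0 : 0 < t.
  by rewrite divr_gt0// exprn_gt0// lt_def rnorm_ge0 ?rv0 ?qv0.
have zt : z = t%:C.
  have : inner (r' (r v0)) v0 = inner (r v0) (r v0) by rewrite (adjoint_sym adr).
  rewrite rr innerZl -[q v0](projectionK v0 qA) sq !innervv => h.
  rewrite /t rmorphM fmorphV /= -h mulfK//; apply: contra qv0.
  by rewrite -[0]/(0%:C) => /eqP/(@complexI R)/eqP; rewrite sqrf_eq0.
pose c : R := (Num.sqrt t)^-1.
have ct : c * c * t = 1.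
  by rewrite /c -invfM -expr2 (sqr_sqrtr (ltW t0)) mulVf// lt0r_neq0.
pose a' i := if unlift ord0 i is Some j then a j else fun v => c%:C *: r v.
pose s' i := if unlift ord0 i is Some j then s j else fun v => c%:C *: r' v.
exists a', s'; split.
- by move=> i; rewrite /a'; case: unliftP => [j _|_]; [exact: Aa|exact: starZ].
- move=> i; rewrite /a' /s'; case: unliftP => [j _|_]; first exact: adj.
  by move=> u v; rewrite innerZl innerZr conjc_real adr.
- by move=> i v; rewrite /a'; case: unliftP => [j _|_]; rewrite ?aq ?rq.
- move=> i j v; rewrite /a' /s'; case: unliftP => [i' ->|->]; case: unliftP => [j' ->|->].
  + by rewrite sa (inj_eq lift_inj).
  + by rewrite (linZ (ls i')) sr scaler0 eq_sym (negPf (neq_lift _ _)) scale0r.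
  + by rewrite r'a scaler0 (negPf (neq_lift _ _)) scale0r.
  + rewrite (linZ lr') rr zt !scalerA eqxx; congr (_ *: _).
    by rewrite -!rmorphM /= ct.
Qed.

(** Incomplete frames extend, so without a complete one there would be frames of every length,
    although their members are independent. *)
Lemma complete_frame A q : star_subalgebra A -> finite_dimensional A ->
    projection_in A q -> q <> 0 ->
    (forall y, A y -> exists z : R[i], forall v, q (y (q v)) = z *: q v) ->
  exists n (a s : 'I_n -> H -> H), frame A q a s /\
    forall x v, A x -> x (q v) = \sum_(i < n) a i (s i (x (q v))).
Proof.
move=> sA fA qA q0 scal; apply: contrapT => ninc.
have fr n : exists a s : 'I_n -> H -> H, frame A q a s.
  elim: n => [|n [a [s fas]]].
    by exists (fun=> 0), (fun=> 0); split; case.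
  apply: contrapT => next; apply: ninc; exists n, a, s; split=> // x v Ax.
  by apply: contrapT => xv; apply: next; exact: frame_extend scal fas Ax xv.
have [k kP] := finite_dimensional_dependent fA.
have [a [s [Aa adj aq sa]]] := fr k.+1.
have [c c0 ca] := kP _ a (ltnSn k) Aa.
have [v qv] := projection_neq0 q0.
move/negP: c0; apply; apply/eqP/rowP => i; rewrite mxE.
have ls : linear (s i) := star_linear sA (star_adjoint sA (Aa i) (adj i)).
have := congr1 (s i) (ca v); rewrite (lin_sum _ _ ls) (lin0 ls) (bigD1 i)//=.
rewrite (linZ ls) sa eqxx scale1r big1 => [|j ji]; last first.
  by rewrite (linZ ls) sa eq_sym (negPf ji) scale0r scaler0.
by rewrite addr0 => /eqP; rewrite scaler_eq0 => /orP[/eqP//|/eqP].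
Qed.

(** The elements annihilating the range of every a q form a two-sided ideal, which misses the
    identity because q <> 0. *)
Lemma simple_faithful A q : star_subalgebra A -> simple_algebra A -> A idfun ->
    A q -> q <> 0 ->
  forall x, A x -> (forall a v, A a -> x (a (q v)) = 0) -> forall v, x v = 0.
Proof.
move=> sA [_ simpleA] Aid Aq q0 x Ax xq.
pose J := [set y | A y /\ forall a v, A a -> y (a (q v)) = 0].
have Jideal : two_sided_ideal A J.
  split; first by move=> y [].
    split; first by split=> //; exact: star0.
    move=> c y z [Ay yq] [Az zq]; split; first exact: star_lin.
    by move=> a v Aa; rewrite op_linE yq// zq// scaler0 addr0.
  move=> a y Aa [Ay yq]; split; split.
  - exact: star_comp.
  - by move=> b v Ab /=; rewrite yq// (lin0 (star_linear sA Aa)).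
  - exact: star_comp.
  - by move=> b v Ab /=; apply: (yq (a \o b)); exact: star_comp.
have [J0|JA] := simpleA _ Jideal.
  have : J x by [].
  by rewrite J0 => ->.
have : J idfun by rewrite JA.
by case=> _ h; case: q0; apply/funext => v; exact: (h idfun).
Qed.

(** The products a_i s_j from a complete frame over a minimal projection are matrix units. Existence
    matters because [restricted_entropy] falls back to 0 when no isomorphism exists, and a bound on
    it would then say nothing. *)
Lemma matrix_star_iso_exists A : star_subalgebra A -> finite_dimensional A ->
    simple_algebra A -> A idfun ->
  exists d (phi : 'M[R[i]]_d -> H -> H), matrix_star_iso phi A.
Proof.
move=> sA fA simpA Aid.
have [v0 v00] : exists v : H, v <> 0.
  have [[a _ a0] _] := simpA; apply: contrapT => h; apply: a0; apply/funext => v.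
  by apply: contrapT => av; apply: h; exists (a v).
have [|q [qA q0 scal]] := minimal_projection sA fA Aid; first by exists v0.
have [d [a [s [[Aa adj aq sa] comp]]]] := complete_frame sA fA qA q0 scal.
have [Aq _ sq] := qA.
have As i : A (s i) := star_adjoint sA (Aa i) (adj i).
have lq := star_linear sA Aq.
have la i := star_linear sA (Aa i); have ls i := star_linear sA (As i).
have qs i v : q (s i v) = s i v.
  by apply: eq_inner_r => w; rewrite -sq -adj aq adj.
(* By completeness the difference of the two sides kills the range of every x q, and simplicity
   makes it zero. *)
have unit v : \sum_(i < d) a i (s i v) = v.
  apply/eqP; rewrite -subr_eq0; apply/eqP.
  have AP : A (fun v => \sum_(i < d) (a i \o s i) v - v).
    apply: (starB (b := idfun) sA) => //.
    apply: (star_sum (F := fun i => a i \o s i) sA) => i.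
    exact: star_comp.
  apply: (simple_faithful sA simpA Aid Aq q0 AP) => x u Ax.
  by rewrite -comp// subrr.
pose phi (X : 'M[R[i]]_d) v := \sum_(i < d) \sum_(j < d) X i j *: a i (s j v).
have sphi X i j v : s i (phi X (a j v)) = X i j *: q v.
  rewrite /phi (lin_sum _ _ (ls i)) (bigD1 i)//= [X in _ + X = _]big1 => [|k ki]; last first.
    rewrite (lin_sum _ _ (ls i)) big1// => l _.
    by rewrite (linZ (ls i)) sa eq_sym (negPf ki) scale0r scaler0.
  rewrite addr0 (lin_sum _ _ (ls i)) (bigD1 j)//= big1 => [|l lj].
    by rewrite addr0 (linZ (ls i)) !sa !eqxx !scale1r (projectionK _ qA).
  by rewrite sa (negPf lj) scale0r (lin0 (la i)) scaler0 (lin0 (ls i)).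
exists d, phi; split.
- split.
    move=> X Y XY; have [v qv] := projection_neq0 q0.
    apply/matrixP => i j; apply/eqP; rewrite -subr_eq0.
    have /eqP := sphi X i j v; rewrite XY sphi -subr_eq0 -scalerBl scaler_eq0 => /orP[|/eqP//].
    by rewrite -oppr_eq0 opprB.
  apply/seteqP; split=> [_ [X _ <-]|x Ax].
    apply: (star_sum (F := fun i v => \sum_(j < d) X i j *: a i (s j v)) sA) => i.
    apply: (star_sum (F := fun j v => X i j *: a i (s j v)) sA) => j.
    by apply: (starZ _ sA (a := a i \o s j)); exact: star_comp.
  have lx := star_linear sA Ax.
  (* s_i x a_j lies in the corner of q, hence is a multiple of q; the scalar is the (i, j) entry of
     the preimage of x. *)
  have /choice[X XP] : forall ij : 'I_d * 'I_d, exists z : R[i],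
      forall v, s ij.1 (x (a ij.2 v)) = z *: q v.
    move=> [i j]; have [z zP] := scal (s i \o (x \o a j)) (star_comp sA (As i) (star_comp sA Ax (Aa j))).
    by exists z => v; rewrite -zP /= aq qs.
  exists (\matrix_(i, j) X (i, j)) => //; apply/funext => v.
  rewrite -[RHS]unit; apply: eq_bigr => i _.
  rewrite -[in RHS](unit v) (lin_sum _ _ lx) (lin_sum _ _ (ls i)).
  rewrite (lin_sum _ _ (la i)); apply: eq_bigr => j _.
  by rewrite mxE (XP (i, j)) qs (linZ (la i)).
- move=> c X Y; apply/funext => v; rewrite op_linE /phi scaler_sumr -big_split /=.
  apply: eq_bigr => i _; rewrite scaler_sumr -big_split /=; apply: eq_bigr => j _.
  by rewrite !mxE scalerDl scalerA.
- move=> X Y; apply/funext => v; rewrite /= {1 2}/phi; apply: eq_bigr => i _.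
  have sY j : s j (phi Y v) = \sum_(l < d) Y j l *: s l v.
    rewrite -{1}(unit v).
    rewrite /phi (lin_sum _ _ (ls j)) (bigD1 j)//= [X in _ + X = _]big1 => [|k kj]; last first.
      rewrite (lin_sum _ _ (ls j)) big1// => l _.
      by rewrite (linZ (ls j)) sa eq_sym (negPf kj) scale0r scaler0.
    rewrite addr0 (lin_sum _ _ (ls j)); apply: eq_bigr => l _.
    by rewrite (linZ (ls j)) sa eqxx scale1r qs unit.
  under [RHS]eq_bigr => j _ do rewrite sY (lin_sum _ _ (la i)) scaler_sumr.
  rewrite exchange_big /=; apply: eq_bigr => l _.
  rewrite mxE scaler_suml; apply: eq_bigr => j _.
  by rewrite (linZ (la i)) scalerA.
- move=> X v w; rewrite /phi inner_suml inner_sumr.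
  under eq_bigr => i _ do rewrite inner_suml.
  under [RHS]eq_bigr => i _ do rewrite inner_sumr.
  rewrite exchange_big /=; apply: eq_bigr => j _; apply: eq_bigr => i _.
  rewrite !mxE innerZl innerZr adj (adjoint_sym (adj j)).
  by rewrite -[_^*%C]/((Num.conj (X i j))^*%C) conjcK.
Qed.

End MatrixUnits.

(** * Density matrices, entropy and large eigenvalues *)

Section Entropy.
Context {R : realType} {H : hilbertType R}.
Implicit Types (u v w Psi : H) (A : set (H -> H)).
Local Notation adjmx X := (X ^t (@Num.conj R[i])).

Lemma trace_spectral d (rho Y : 'M[R[i]]_d) : adjmx rho = rho ->
  \tr (rho *m Y) = \sum_(k < d) spectral_diag rho 0 k *
    (spectralmx rho *m Y *m adjmx (spectralmx rho)) k k.
Proof.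
move=> hrho; set U := spectralmx rho; set D := spectral_diag rho.
have /orthomx_spectralP rhoE : rho \is normalmx by apply/normalmxP; rewrite hrho.
have UU : invmx U = adjmx U by apply: invmx_unitary; exact: spectral_unitarymx.
rewrite {1}rhoE -/U -/D UU -!mulmxA mxtrace_mulC -!mulmxA.
by rewrite /mxtrace; apply: eq_bigr => k _; rewrite mul_diag_mx mxE mulmxA.
Qed.

Lemma adjmxM m n p (X : 'M[R[i]]_(m, n)) (Y : 'M[R[i]]_(n, p)) :
  adjmx (X *m Y) = adjmx Y *m adjmx X.
Proof. by rewrite trmx_mul map_mxM. Qed.

Section Isomorphism.
Variables (d : nat) (phi : 'M[R[i]]_d -> H -> H) (A : set (H -> H)).
Hypotheses (Aid : A idfun) (iso : matrix_star_iso phi A).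

Let phiM X Y v : phi (X *m Y) v = phi X (phi Y v).
Proof. by case: iso => _ _ h _; rewrite h. Qed.

Let phi_lin c X Y v : phi (c *: X + Y) v = c *: phi X v + phi Y v.
Proof. by case: iso => _ h _ _; rewrite h. Qed.

Let phi_adj X v w : inner (phi X v) w = inner v (phi (adjmx X) w).
Proof. by case: iso => _ _ _ h; exact: h. Qed.

Let phi1 v : phi 1%:M v = v.
Proof.
have [[_ rangeA] _ _ _] := iso.
have [Y _ Yid] : range phi idfun by rewrite rangeA.
have Yv u : phi Y u = u by rewrite Yid.
by rewrite -[phi 1%:M v]Yv -phiM mulmx1 Yv.
Qed.

Let phi0 v : phi 0 v = 0.
Proof.
by have := phi_lin (-1) 0 0 v; rewrite scaler0 addr0 scaleN1r addNr.
Qed.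

Let phi_sum (I : Type) (s : seq I) (F : I -> 'M[R[i]]_d) v :
  phi (\sum_(i <- s) F i) v = \sum_(i <- s) phi (F i) v.
Proof.
apply: (big_morph (fun X => phi X v)) => [X Y|]; last exact: phi0.
by have := phi_lin 1 X Y v; rewrite !scale1r.
Qed.

Let phiZ c X v : phi (c *: X) v = c *: phi X v.
Proof. by have := phi_lin c X 0 v; rewrite phi0 !addr0. Qed.

(** Testing on matrix units forces the (i, j) entry to be the value of the state at the unit (j,
    i). *)
Lemma density_matrix_exists Psi : exists rho, is_density_matrix phi Psi rho.
Proof.
exists (\matrix_(i, j) inner (phi (delta_mx j i) Psi) Psi) => X.
rewrite [in RHS](matrix_sum_delta X) phi_sum inner_suml /mxtrace.
under [RHS]eq_bigr => i _ do rewrite phi_sum inner_suml.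
rewrite [RHS]exchange_big /=; apply: eq_bigr => i _; rewrite mxE.
by apply: eq_bigr => j _; rewrite mxE phiZ innerZl mulrC.
Qed.

Variables (Psi : H) (rho : 'M[R[i]]_d).
Hypotheses (Psi1 : rnorm Psi = 1) (rhoP : is_density_matrix phi Psi rho).

Let rho_delta i j : rho i j = inner (phi (delta_mx j i) Psi) Psi.
Proof.
rewrite -rhoP /mxtrace (bigD1 i)//= [X in _ + X]big1 => [|k ki].
  rewrite addr0 mxE (bigD1 j)//= mxE !eqxx mulr1 [X in _ + X]big1 ?addr0// => l lj.
  by rewrite mxE (negPf lj) mulr0.
by rewrite mxE big1// => l _; rewrite mxE (negPf ki) andbF mulr0.
Qed.

Let rho_herm : adjmx rho = rho.
Proof.
apply/matrixP => i j; rewrite !mxE !rho_delta phi_adj.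
rewrite trmx_delta map_delta_mx.
by rewrite -[LHS]/((inner Psi (phi (delta_mx j i) Psi))^*%C) -innerC.
Qed.

Let U := spectralmx rho.
(** Projection onto the line of the j-th vector of an eigenbasis of rho: it is minimal even when the
    eigenvalue is multiple. *)
Let E j : 'M[R[i]]_d := adjmx U *m delta_mx j j *m U.

Let UV : U *m adjmx U = 1%:M.
Proof. by apply/unitarymxP; exact: spectral_unitarymx. Qed.

Let E_adj j : adjmx (E j) = E j.
Proof.
rewrite /E !adjmxM trmx_delta map_delta_mx mulmxA; congr (_ *m _).
exact: trmxCK.
Qed.

Let E_compress j Y : E j *m Y *m E j = (U *m Y *m adjmx U) j j *: E j.
Proof.
set B := U *m Y *m adjmx U.
have : E j *m Y *m E j = adjmx U *m (delta_mx j j *m B *m delta_mx j j) *m U.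
  by rewrite /E /B !mulmxA.
have -> : delta_mx j j *m B *m delta_mx j j = B j j *: delta_mx j j.
  (* [delta_mx j j] factors as a column times a row, which isolates a 1 x 1 block. *)
  have key : delta_mx (0 : 'I_1) j *m B *m delta_mx j (0 : 'I_1) = (B j j)%:M.
    by rewrite -rowE -colE; apply/matrixP => i k; rewrite !ord1 !mxE eqxx.
  rewrite -(mul_delta_mx (0 : 'I_1)).
  transitivity (delta_mx j (0 : 'I_1) *m (delta_mx (0 : 'I_1) j *m B *m delta_mx j (0 : 'I_1))
      *m delta_mx (0 : 'I_1) j).
    by rewrite !mulmxA.
  by rewrite key mul_mx_scalar -scalemxAl.
by move=> ->; rewrite -scalemxAr -scalemxAl.
Qed.

Let E_idem j : E j *m E j = E j.
Proof.
rewrite -{1}[E j]mulmx1 E_compress mulmx1.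
by rewrite -/U UV mxE eqxx scale1r.
Qed.

(** The j-th eigenvalue of rho, by [weightE], in a form that is visibly real and nonnegative. *)
Let weight j : R := rnorm (phi (E j) Psi) ^+ 2.

Let inner_E j v : inner (phi (E j) v) v = (rnorm (phi (E j) v) ^+ 2)%:C.
Proof. by rewrite -innervv [in RHS]phi_adj E_adj -phiM E_idem [in LHS]phi_adj E_adj. Qed.

Let weightE j : spectral_diag rho 0 j = (weight j)%:C.
Proof.
rewrite -inner_E -rhoP trace_spectral// -/U (bigD1 j)//= [X in _ + X]big1 => [|k kj].
  by rewrite addr0 /E !mulmxA UV mul1mx -mulmxA UV mulmx1 mxE !eqxx mulr1.
by rewrite /E !mulmxA UV mul1mx -mulmxA UV mulmx1 mxE (negPf kj) mulr0.
Qed.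

Let weight_sum : \sum_(j < d) weight j = 1.
Proof.
apply: (@complexI R); rewrite rmorph_sum /=.
have := rhoP 1%:M; rewrite phi1 innervv Psi1 expr1n => <-.
rewrite trace_spectral//; apply: eq_bigr => j _.
by rewrite -/U mulmx1 UV mxE eqxx mulr1 weightE.
Qed.

Let entropyE : von_neumann_entropy rho = - \sum_(j < d) weight j * ln (weight j).
Proof.
rewrite /von_neumann_entropy; congr (- _).
rewrite trace_spectral// (_ : \sum_(k < d) _ = (\sum_(j < d) weight j * ln (weight j))%:C)//.
rewrite rmorph_sum; apply: eq_bigr => j _; rewrite rmorphM /= weightE; congr (_ * _).
have UU : invmx U = adjmx U by apply: invmx_unitary; exact: spectral_unitarymx.
rewrite /mx_log -/U UU !mulmxA UV mul1mx -mulmxA UV mulmx1 !mxE eqxx mulr1n.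
by rewrite weightE.
Qed.

(* - S(rho) is the average of the ln p for the eigenvalues p of rho (weights p), so it
   is at most their maximum. *)
Lemma large_weight : exists j, expR (- von_neumann_entropy rho) <= weight j.
Proof.
apply: contrapT => small; set S := von_neumann_entropy rho in small *.
have {}small j : weight j < expR (- S).
  by rewrite ltNge; apply/negP => h; apply: small; exists j.
have w0 j : 0 <= weight j := sqr_ge0 _.
have term j : weight j * ln (weight j) <= weight j * - S.
  have [->|n0] := eqVneq (weight j) 0; first by rewrite !mul0r.
  have wp : 0 < weight j by rewrite lt_def n0 w0.
  by apply: ler_wpM2l => //; rewrite -(expRK (- S)) ler_ln ?posrE ?expR_gt0// ltW.
(* Terms of weight 0 vanish on both sides; one positive weight makes the inequality of sums
   strict. *)
have [j wj] : exists j, 0 < weight j.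
  apply: contrapT => h; have := weight_sum; rewrite big1 => [/eqP|j _].
    by rewrite eq_sym oner_eq0.
  apply/eqP; rewrite eq_le w0 andbT leNgt; apply/negP => wj; apply: h.
  by exists j.
have : \sum_(j < d) weight j * ln (weight j) < \sum_(j < d) weight j * - S.
  rewrite (bigD1 j)//= [ltRHS](bigD1 j)//=; apply: ltr_leD; last exact: ler_sum.
  by rewrite ltr_pM2l// -(expRK (- S)) ltr_ln ?posrE ?expR_gt0.
rewrite -mulr_suml weight_sum mul1r /S entropyE opprK.
by rewrite ltxx.
Qed.

(** Let T_k be the k-th diagonal entry of X^* X in the eigenbasis. Then |x Psi|^2 is the sum of the
    weight_k T_k, hence at least weight_j T_j, and |x (E_j v)|^2 = T_j |E_j v|^2. *)
Lemma minimal_compression j : [/\ A (phi (E j)), is_adjoint (phi (E j)) (phi (E j)),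
  forall v, rnorm (phi (E j) v) <= rnorm v, rinner (phi (E j) Psi) Psi = weight j
  & forall x v, A x ->
      weight j * rnorm (x (phi (E j) v)) ^+ 2 <= rnorm (x Psi) ^+ 2 * rnorm v ^+ 2].
Proof.
have [[_ rangeA] _ _ _] := iso.
have le1 v : rnorm (phi (E j) v) <= rnorm v.
  have [->|n0] := eqVneq (rnorm (phi (E j) v)) 0; first exact: rnorm_ge0.
  have n1 : 0 < rnorm (phi (E j) v) by rewrite lt_def n0 rnorm_ge0.
  rewrite -(ler_pM2l n1) -expr2.
  have <- : rinner (phi (E j) v) v = rnorm (phi (E j) v) ^+ 2 by rewrite /rinner inner_E.
  by apply: le_trans (ler_norm _) _; exact: rinner_CauchySchwarz.
split=> //.
- by rewrite -rangeA; exists (E j).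
- by move=> u v; rewrite phi_adj E_adj.
- by rewrite /rinner inner_E.
move=> x v; rewrite -rangeA => -[X _ <-].
pose W := X *m adjmx U.
pose T k : R := \sum_(l < d) rnorm (W l k) ^+ 2.
have T0 k : 0 <= T k by apply: sumr_ge0 => l _; exact: sqr_ge0.
have TE k : (U *m (adjmx X *m X) *m adjmx U) k k = (T k)%:C.
  have -> : U *m (adjmx X *m X) *m adjmx U = adjmx W *m W.
    by rewrite /W adjmxM trmxCK !mulmxA.
  rewrite mxE rmorph_sum; apply: eq_bigr => l _; rewrite !mxE.
  by rewrite rmorphXn /= -rnormE normCK mulrC.
have adjXX : adjmx (adjmx X *m X) = adjmx X *m X by rewrite adjmxM trmxCK.
have innerX u w : inner (phi X u) (phi X w) = inner (phi (adjmx X *m X) u) w.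
  by rewrite phi_adj -phiM [RHS]phi_adj adjXX.
have h1 : rnorm (phi X Psi) ^+ 2 = \sum_(k < d) weight k * T k.
  apply: (@complexI R); rewrite -innervv innerX -rhoP trace_spectral// rmorph_sum.
  by apply: eq_bigr => k _; rewrite -/U TE weightE [RHS]rmorphM.
have h2 : rnorm (phi X (phi (E j) v)) ^+ 2 = T j * rnorm (phi (E j) v) ^+ 2.
  apply: (@complexI R); rewrite -innervv innerX -phiM -{2}E_adj -phi_adj -phiM mulmxA.
  by rewrite E_compress TE phiZ innerZl inner_E [RHS]rmorphM.
rewrite h2 h1 mulrA; apply: ler_pM => //.
- by rewrite mulr_ge0 ?sqr_ge0.
- exact: sqr_ge0.
- rewrite (bigD1 j)//= lerDl; apply: sumr_ge0 => k _.
  by rewrite mulr_ge0 ?sqr_ge0.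
- by rewrite ler_pXn2r ?nnegrE ?rnorm_ge0.
Qed.

End Isomorphism.

Lemma entropy_compression A Psi (s : R) : star_subalgebra A -> A idfun ->
    finite_dimensional A -> simple_algebra A -> rnorm Psi = 1 ->
    restricted_entropy Psi A <= s ->
  exists e, [/\ A e, is_adjoint e e, forall v, rnorm (e v) <= rnorm v,
    expR (- s) <= rinner (e Psi) Psi
    & forall x v, A x -> rnorm (x (e v)) <= (Num.sqrt (expR (- s)))^-1 * rnorm (x Psi) * rnorm v].
Proof.
move=> sA Aid fA simpA Psi1 Ss.
have [d [phi iso]] := matrix_star_iso_exists sA fA simpA Aid.
have [rho rhoP] := density_matrix_exists iso Psi.
(* The isomorphism just built only shows that the set of candidate entropies is inhabited; [xget]
   may return the value of another one, and the eigenvalue estimate is applied to that one. *)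
have [d' [phi' [rho' [iso' rhoP' SE]]]] : exists (d : nat) (phi : 'M[R[i]]_d -> H -> H)
    (rho : 'M[R[i]]_d), [/\ matrix_star_iso phi A, is_density_matrix phi Psi rho
      & restricted_entropy Psi A = von_neumann_entropy rho].
  rewrite /restricted_entropy; set E := [set t | _].
  have Erho : E (von_neumann_entropy rho) by exists d, phi, rho.
  exact: (xgetPex 0 (ex_intro _ _ Erho)).
have [j wj] := large_weight Aid iso' Psi1 rhoP'.
have [Ae se e1 eP ex] := minimal_compression iso' rhoP' j.
eexists; split; [exact: Ae|exact: se|exact: e1| |].
  rewrite eP; apply: (le_trans _ wj); rewrite ler_expR lerN2 -SE.
  exact: Ss.
move=> x v Ax.
have c0 : 0 < expR (- s) by exact: expR_gt0.
have c1 : 0 < Num.sqrt (expR (- s)) by rewrite sqrtr_gt0.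
rewrite -mulrA ler_pdivlMl// -(ler_pXn2r (n := 2))// ?nnegrE ?mulr_ge0 ?rnorm_ge0 ?sqrtr_ge0//.
rewrite !exprMn (sqr_sqrtr (ltW c0)); apply: (le_trans _ (ex x v Ax)).
apply: ler_wpM2r; first exact: sqr_ge0.
apply: (le_trans _ wj); rewrite ler_expR lerN2 -SE.
exact: Ss.
Qed.

End Entropy.

Theorem theoremA1 (R : realType) (H : hilbertType R)
    (H_separable : separable_space H)
    (M : set (H -> H)) (Psi : H)
    (M_factor : is_factor M)
    (Psi_unit : `|Psi| = 1)
    (Psi_cyclic : cyclic_vector M Psi)
    (Psi_separating : separating_vector M Psi)
    (ex_Mn : exists Mn : nat -> set (H -> H),
      [/\ forall m n : nat, (m <= n)%N -> Mn m `<=` Mn n,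
          forall n : nat,
            [/\ star_subalgebra (Mn n), Mn n `<=` M, Mn n idfun,
                finite_dimensional (Mn n) & simple_algebra (Mn n)],
          (ereal_sup (range (fun n : nat =>
             (restricted_entropy Psi (Mn n))%:E)) < +oo)%E
        & M = wot_closure (\bigcup_n Mn n)]) :
  type_I M.
Proof.
have [Mn [mono MnP Ssup Mcl]] := ex_Mn; have [vM centerM] := M_factor.
have Psi1 : rnorm Psi = 1 by rewrite /rnorm Psi_unit.
have [s Ss] : exists s : R, forall n, restricted_entropy Psi (Mn n) <= s.
  have le_sup n : ((restricted_entropy Psi (Mn n))%:E <=
      ereal_sup (range (fun n : nat => (restricted_entropy Psi (Mn n))%:E)))%E.
    by apply: ereal_sup_ubound; exists n.
  (* The supremum is not -oo either, since it dominates the real entropy at index 0. *)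
  move: Ssup le_sup; case: ereal_sup => [s _|//|_] le_sup.
    by exists s => n; have := le_sup n; rewrite lee_fin.
  by have := le_sup 0%N; rewrite leeNy_eq.
have c0 : 0 < expR (- s) :> R by exact: expR_gt0.
have /choice[e eP] : forall n, exists e, [/\ Mn n e, is_adjoint e e,
    forall v, rnorm (e v) <= rnorm v, expR (- s) <= rinner (e Psi) Psi
    & forall x v, Mn n x ->
        rnorm (x (e v)) <= (Num.sqrt (expR (- s)))^-1 * rnorm (x Psi) * rnorm v].
  move=> n; have [sMn MnM Mnid fMn simpMn] := MnP n.
  exact: entropy_compression.
have [|n|n|n x v Mx|n|f [Mf sf tf fK]] :=
  @wot_limit_compression R H Mn M Psi e (Num.sqrt (expR (- s)))^-1 (expR (- s)) vM _ mono _ Mcl.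
- by rewrite invr_ge0 sqrtr_ge0.
- by have [] := MnP n.
- by have [] := eP n.
- by have [_ _ _ _ h] := eP n; exact: h.
- by have [_ _ _ h _] := eP n.
have [|p [abp p0]] := abelian_of_compression vM Psi1 c0 _ Mf sf tf fK.
  by rewrite invr_gt0 sqrtr_gt0.
(* In a factor z is a scalar c with c^2 = c and c <> 0, so z is the identity and majorizes p. *)
move=> z [zM zz _] z0; exists p; split=> //.
have [c _ cz] : range (fun c : R[i] => c *: (idfun : H -> H)) z by rewrite -centerM.
have zE v : z v = c *: v by rewrite -cz.
have [v zv] := projection_neq0 z0.
have c1 : c = 1.
  have /(congr1 (fun f => f v)) := zz; rewrite /= !zE scalerA => /eqP.
  rewrite -subr_eq0 -scalerBl scaler_eq0 => /orP[|/eqP v0]; last first.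
    by case: zv; rewrite zE v0 scaler0.
  rewrite -{3}[c]mulr1 -mulrBr mulf_eq0 => /orP[/eqP c00|].
    by case: zv; rewrite zE c00 scale0r.
  by rewrite subr_eq0 => /eqP.
by apply/funext => u /=; rewrite zE c1 scale1r.
Qed.
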